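(* Let $k,d\ge1$ and let $G$ be a group of automorphisms of $\mathbb{T}_{k,d}$ with finitely many orbits on vertices and on hyperedges, with branching matrices $\mathbf{D}=[d_{ij}]\in\mathbb{Z}_{\ge0}^{\tau_v\times\tau_e}$ and $\mathbf{K}=[k_{ji}]\in\mathbb{Z}_{\ge0}^{\tau_e\times\tau_v}$. There exists a sequence of random finite hypergraphs $\mathcal{H}_n$ (with vertices and hyperedges classified into types) that converges locally to $\mathbb{T}_{k,d}^G$ if and only if the Markov chain with transition matrix $\mathbf{P}=\begin{bmatrix}\mathbf{0}&\frac1{d+1}\mathbf{D}\\ \frac1{k+1}\mathbf{K}&\mathbf{0}\end{bmatrix}$ is time-reversible.
   Context: A hypergraph $(V,E)$ has hyperedges that are subsets of $V$; its incidence graph is the bipartite graph on $V\cup E$ with $v\sim e$ iff $v\in e$. $\mathbb{T}_{k,d}$ is the infinite hypergraph whose incidence graph is the infinite tree with vertex-nodes of degree $d+1$ and hyperedge-nodes of degree $k+1$. An automorphism is a bijection of vertices mapping hyperedges onto hyperedges. For a group $G$ of automorphisms, its orbits on vertices are the vertex types $1,\dots,\tau_v$ and its orbits on hyperedges the hyperedge types $1,\dots,\tau_e$; the branching matrices satisfy: every vertex of type $i$ lies in exactly $d_{ij}$ hyperedges of type $j$, every hyperedge of type $j$ contains exactly $k_{ji}$ vertices of type $i$. $\mathbb{T}_{k,d}^G$ denotes $\mathbb{T}_{k,d}$ with vertices and hyperedges labeled by their types. For a hypergraph $\mathcal{H}$ and vertex $v$, $N_t(v)$ is the sub-hypergraph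 induced by the vertices at distance at most $t$ from $v$ (vertices adjacent iff they share a hyperedge), with the types inherited; $\mathbb{T}_{k,d}^G(t,i)$ is $N_t(v)$ in $\mathbb{T}_{k,d}^G$ for any vertex $v$ of type $i$ (independent of the choice of $v$), rooted at $v$. A sequence of random finite hypergraphs $\mathcal{H}_n=(V_n,E_n)$, with $V_n=\biguplus_{i\in[\tau_v]}V_{n,i}$ and $E_n=\biguplus_{j\in[\tau_e]}E_{n,j}$ partitioned into types, converges locally to $\mathbb{T}_{k,d}^G$ if for every $t\ge0$ and $i\in[\tau_v]$, with $I_{n,i}$ a uniformly random vertex of $V_{n,i}$, $\lim_{n\to\infty}\Pr\big(N_t(I_{n,i})\cong\mathbb{T}_{k,d}^G(t,i)\big)=1$ under the joint law of $(\mathcal{H}_n,I_{n,i})$, where $\cong$ is a rooted isomorphism preserving vertex and hyperedge types and incidence. The chain $\mathbf{P}$ has state space the vertex types together with the hyperedge types, moving from vertex type $i$ to hyperedge type $j$ with probability $d_{ij}/(d+1)$ and from hyperedge type $j$ to vertex type $i$ with probability $k_{ji}/(k+1)$. It is time-reversible if there is a probability vector $\pi$ with positive entries on its states such that $\pi_a\mathbf{P}_{ab}=\pi_b\mathbf{P}_{ba}$ for all states $a,b$. *)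

(* Defs.v *)
From mathcomp Require Import all_boot all_order all_algebra.
From mathcomp Require Import all_classical all_reals all_analysis.
Import Order.TTheory GRing.Theory Num.Theory.
Import numFieldNormedType.Exports.

Set Implicit Arguments.
Unset Strict Implicit.
Unset Printing Implicit Defensive.

Local Open Scope classical_set_scope.
Local Open Scope card_scope.
Local Open Scope ring_scope.

Section Graph.
Variables (X : eqType) (adj : rel X).

Definition graph_connected : Prop :=
  forall x y, exists2 s, path adj x s & last x s = y.

(* [ucycle] also accepts x, y, x traversed along one edge, which is not a
   cycle of a simple graph; hence the bound 2. *)
Definition graph_acyclic : Prop :=
  forall s : seq X, ucycle adj s -> (size s <= 2)%N.

Definition is_tree : Prop :=
  [/\ inhabited X, graph_connected & graph_acyclic].

Definition has_degree (x : X) (n : nat) : Prop := [set y | adj x y] #= `I_n.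

Definition dist_le (t : nat) (x y : X) : Prop :=
  exists s, [/\ path adj x s, last x s = y & (size s <= t)%N].

End Graph.

Definition hypergraph (V : choiceType) := set (set V).

Section Hypergraph.
Variables (V : choiceType) (H : hypergraph V).

Definition incidence_adj : rel (V + set_type H)%type := fun x y =>
  match x, y with
  | inl v, inr e => v \in val e
  | inr e, inl v => v \in val e
  | _, _ => false
  end.

Definition vertex_adj (u v : V) : bool :=
  `[< exists2 e, H e & e u /\ e v >].

(* H is T_{k,d}; this tree, hence H, is unique up to isomorphism, and it is
   infinite as soon as k, d >= 1. *)
Definition is_tree_hypergraph (k d : nat) : Prop :=
  [/\ is_tree incidence_adj,
      forall v : V, has_degree incidence_adj (inl v) d.+1
    & forall e : set_type H, has_degree incidence_adj (inr e) k.+1].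

Definition automorphism (g : V -> V) : Prop :=
  bijective g /\ [set g @` e | e in H] = H.

Record automorphism_group (G : set (V -> V)) : Prop := AutomorphismGroup {
  group_automorphism : forall g, G g -> automorphism g;
  group_id : G id;
  group_comp : forall g h, G g -> G h -> G (g \o h);
  group_inv : forall g, G g -> exists h, [/\ G h, cancel g h & cancel h g]
}.

End Hypergraph.

(* The values of [etype] on sets that are not hyperedges are irrelevant. *)
Record typed_hypergraph (tv te : nat) (V : choiceType) := TypedHypergraph {
  hyperedges :> hypergraph V;
  vtype : V -> 'I_tv;
  etype : set V -> 'I_te
}.

Section TypedHypergraph.
Variables (tv te : nat) (V : choiceType) (H : typed_hypergraph tv te V).

(* Every label is used and two objects carry the same label iff they lie in
   the same G-orbit: the labels enumerate the orbits. *)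
Record types_are_orbits (G : set (V -> V)) : Prop := TypesAreOrbits {
  vtype_orbit : forall u v, vtype H u = vtype H v <-> exists2 g, G g & g u = v;
  vtype_surj : forall i, exists v, vtype H v = i;
  etype_orbit : forall e f, hyperedges H e -> hyperedges H f ->
    (etype H e = etype H f <-> exists2 g, G g & g @` e = f);
  etype_surj : forall j, exists2 e, hyperedges H e & etype H e = j
}.

Definition branching_matrices (D : 'M[nat]_(tv, te)) (K : 'M[nat]_(te, tv))
    : Prop :=
  (forall v j, [set e | [/\ hyperedges H e, e v & etype H e = j]]
     #= `I_(D (vtype H v) j))
  /\
  (forall e i, hyperedges H e ->
     [set v | e v /\ vtype H v = i] #= `I_(K (etype H e) i)).

Definition nbhd_set (t : nat) (v : V) : set V :=
  [set u | dist_le (vertex_adj H) t v u].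

Lemma nbhd_set_root (t : nat) (v : V) : v \in nbhd_set t v.
Proof. by apply/mem_set; exists [::]. Qed.

Definition nbhd_root (t : nat) (v : V) : set_type (nbhd_set t v) :=
  exist _ v (nbhd_set_root t v).

(* The hyperedges of an induced sub-hypergraph are the hyperedges of H all of
   whose vertices are kept. *)
Definition nbhd (t : nat) (v : V)
    : typed_hypergraph tv te (set_type (nbhd_set t v)) :=
  {| hyperedges := [set e | hyperedges H (val @` e)];
     vtype := fun u => vtype H (val u);
     etype := fun e => etype H (val @` e) |}.

End TypedHypergraph.

Definition rooted_iso (tv te : nat) (V W : choiceType)
    (H : typed_hypergraph tv te V) (r : V)
    (H' : typed_hypergraph tv te W) (r' : W) : Prop :=
  exists f : V -> W,
    [/\ bijective f,
        f r = r',
        [set f @` e | e in hyperedges H] = hyperedges H',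
        forall v, vtype H' (f v) = vtype H v
      & forall e, hyperedges H e -> etype H' (f @` e) = etype H e].

Definition nbhd_iso (tv te : nat) (t : nat) (V W : choiceType)
    (H : typed_hypergraph tv te V) (v : V)
    (H' : typed_hypergraph tv te W) (w : W) : Prop :=
  rooted_iso (nbhd H t v) (nbhd_root H t v) (nbhd H' t w) (nbhd_root H' t w).

(* Every vertex type has to occur for a uniformly random vertex of that type
   to exist. *)
Record finite_typed_hypergraph (tv te : nat) := FiniteTypedHypergraph {
  fin_order : nat;
  fin_hypergraph :> typed_hypergraph tv te 'I_fin_order;
  fin_vtype_surj : forall i, exists v, vtype fin_hypergraph v = i
}.

(* The finite typed hypergraphs on the vertex sets 'I_n are countably many;
   they are given the discrete sigma-algebra. *)
Record random_hypergraph (R : realType) (tv te : nat) := RandomHypergraph {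
  rh_display : measure_display;
  rh_space : measurableType rh_display;
  rh_prob : probability rh_space R;
  rh_fun :> rh_space -> finite_typed_hypergraph tv te;
  rh_measurable : forall A, measurable (rh_fun @^-1` A)
}.

Section LocalConvergence.
Variables (R : realType) (tv te : nat).

Definition vertices_of_type (h : finite_typed_hypergraph tv te) (i : 'I_tv)
    : {set 'I_(fin_order h)} := [set v | vtype h v == i]%SET.

(* Probability of A(H, I) where, conditionally on H, the vertex I is uniform
   among the vertices of type i. *)
Definition prob_uniform_root (H : random_hypergraph R tv te) (i : 'I_tv)
    (A : forall h : finite_typed_hypergraph tv te, 'I_(fin_order h) -> Prop)
    : \bar R :=
  (\int[rh_prob H]_w
     (#|[set v in vertices_of_type (H w) i | `[< A (H w) v >]]%SET|%:R
      / #|vertices_of_type (H w) i|%:R)%:E)%E.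

Definition converges_locally (V : choiceType)
    (H : nat -> random_hypergraph R tv te) (T : typed_hypergraph tv te V)
    : Prop :=
  forall (t : nat) (i : 'I_tv) (v : V), vtype T v = i ->
    prob_uniform_root (H n) i (fun h u => nbhd_iso t h u T v) @[n --> \oo]
      --> 1%E.

End LocalConvergence.

Definition branching_chain (R : realType) (tv te k d : nat)
    (D : 'M[nat]_(tv, te)) (K : 'M[nat]_(te, tv)) : 'M[R]_(tv + te) :=
  block_mx 0 ((d.+1%:R)^-1 *: map_mx (fun m => m%:R) D)
           ((k.+1%:R)^-1 *: map_mx (fun m => m%:R) K) 0.

Definition time_reversible (R : realType) (n : nat) (P : 'M[R]_n) : Prop :=
  exists p : 'rV[R]_n,
    [/\ forall a, 0 < p 0 a,
        \sum_a p 0 a = 1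
      & forall a b, p 0 a * P a b = p 0 b * P b a].

(* Main.v *)
Require Import Defs.
From mathcomp Require Import all_boot all_order all_algebra fingroup perm.
From mathcomp Require Import all_classical all_reals all_analysis measurable_realfun.
From mathcomp Require Import zify ring lra.
Import Order.TTheory GRing.Theory Num.Theory.
Import numFieldNormedType.Exports.

Set Implicit Arguments.
Unset Strict Implicit.
Unset Printing Implicit Defensive.

Local Open Scope classical_set_scope.
Local Open Scope card_scope.

(** If most vertices of H_n look like T, double counting the incidences between
    vertices of type i and hyperedges of type j gives N_i d_ij ~ M_j k_ji, so the
    linear system x_i d_ij = y_j k_ji has approximate, hence exact, nonzero
    solutions. Their absolute values are solutions too, positive because the
    types are connected through T; this is time-reversibility.

    Conversely, connectivity turns a stationary vector into positive integers
    with n_i d_ij = m_j k_ji, which are the class sizes of a finite bipartite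
    multigraph with the degrees of T. Following Biggs, it is lifted by the group
    generated by involutions acting on reduced words in the links; a product of
    at most L successive distinct involutions moves the empty word, so the lift
    has girth more than L. The tree T covers the lift, injectively on balls of
    radius less than L/2. *)

(** An incidence can be traversed both ways, so its label in the group should be its own inverse; a
    repeated letter in the label of a walk is then exactly a backtrack. Truncating words at length
    [L] makes the set acted upon finite, and at most [L] letters applied to the empty word never
    meet the truncation. Hyperedges are vertex sets, so parallel links or coinciding hyperedges of
    the multigraph would be lost; in the lift the absence of short relations separates them. In the
    other direction the vertex classes may a priori grow at different rates, so ratios of their
    sizes need not converge; the balance equations are therefore treated as an approximate kernel of
    one matrix. *)

Fixpoint reduced (X : eqType) (s : seq X) : bool :=
  if s is x :: s' then (if s' is _ :: z :: _ then x != z else true) && reduced s'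
  else true.

(** Phrased by closed walks without backtracking, which the edge labels of the lift exclude
    directly. A backtrack across the base point is allowed. *)
Definition girth_gt (X : eqType) (adj : rel X) (n : nat) : Prop :=
  forall x s, path adj x s -> reduced (x :: s) -> (0 < size s <= n)%N ->
  last x s != x.

(** * Walks without backtracking in trees *)

Section ReducedWalks.
Variables (X : eqType) (adj : rel X).
Hypotheses (adj_sym : symmetric adj) (adj_irr : irreflexive adj).

Lemma uniq_reduced (s : seq X) : uniq s -> reduced s.
Proof.
elim: s => // x s IHs /= /andP[xs us]; rewrite IHs // andbT.
case: s xs us {IHs} => // y [//|z s]; rewrite !inE !negb_or.
by case/and3P.
Qed.

(** The tail is duplicate-free by induction, so a return to the first node closes a [ucycle]. Only
    lengths 1 and 2 remain: a loop, excluded by irreflexivity, and a backtrack, excluded by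
    [reduced]. *)
Lemma acyclic_reduced_uniq (s : seq X) :
  graph_acyclic adj -> sorted adj s -> reduced s -> uniq s.
Proof.
move=> acyc; elim: s => // x s IHs xs /= /andP[rxs rs].
have us : uniq s by apply: IHs => //; apply: path_sorted xs.
rewrite us andbT; apply/negP => xins.
case/splitPr: xins xs rxs us {IHs rs} => s1 s2 /=.
rewrite cat_path /= => /and3P[ps1 adjl _] rxs.
rewrite cat_uniq /= => /and3P[us1 /norP[xs1 _] _].
have /acyc /= : ucycle adj (x :: s1).
  by rewrite /ucycle /= rcons_path ps1 adjl xs1.
case: s1 ps1 adjl rxs us1 xs1 => [|y [|z s1]] //=.
- by rewrite adj_irr.
- by rewrite eqxx.
Qed.

Lemma sorted_catrev (v : X) (p q : seq X) :
  path adj v p -> path adj v q -> sorted adj (catrev p (v :: q)).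
Proof.
elim: p v q => // a p IHp v q /= /andP[va pa] vq.
by apply: IHp => //=; rewrite adj_sym va.
Qed.

(** The walk runs back along [p] to [v] and on along [q]; the only new place for a backtrack is [v],
    where the two heads must differ. *)
Lemma reduced_catrev (v : X) (p q : seq X) :
  uniq (v :: p) -> reduced (v :: q) -> ohead p != ohead q \/ p = [::] ->
  reduced (catrev p (v :: q)).
Proof.
elim: p v q => // a p IHp v q uvp rvq [|//] neq.
have /andP[vap uap] := uvp.
apply: IHp => //.
- rewrite [reduced _]/= -/(reduced (v :: q)) rvq andbT.
  by case: q neq {rvq}.
- case: p uap vap {uvp neq} => [|b p _]; first by right.
  rewrite !inE !negb_or => /and3P[_ vb _]; left => /=.
  by apply: contra vb => /eqP[->].
Qed.

(** From the first node where the paths part, one reversed and glued to the other is a reduced walk,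
    hence duplicate-free, although its two ends agree. *)
Lemma acyclic_uniq_path (v : X) (p q : seq X) : graph_acyclic adj ->
  path adj v p -> path adj v q -> uniq (v :: p) -> uniq (v :: q) ->
  last v p = last v q -> p = q.
Proof.
move=> acyc; elim: p v q => [|a p IHp] v [|b q] //=.
- by move=> _ _ _ /andP[+ _] => /negP vbq vl; case: vbq; rewrite vl mem_last.
- by move=> _ _ /andP[+ _] => /negP vbq _ vl; case: vbq; rewrite -vl mem_last.
move=> /andP[va pa] /andP[vb pb] uvap uvbq eql.
have [ab|nab] := eqVneq a b.
  subst b; congr (_ :: _); apply: IHp pa pb _ _ eql.
  - by case/andP: uvap.
  - by case/andP: uvbq.
have : uniq (catrev (a :: p) (v :: b :: q)).
  apply: acyclic_reduced_uniq => //.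
  - by apply: sorted_catrev => /=; rewrite ?va ?vb.
  - apply: reduced_catrev => //; first exact: uniq_reduced.
    by left; apply: contra nab => /eqP[->].
rewrite catrevE cat_uniq => /and3P[_ /hasPn/(_ (last a p)) + _].
rewrite mem_rev mem_last [in X in X -> _]eql inE mem_last orbT.
by move=> /(_ isT).
Qed.

Lemma shorten_walk (x : X) (p : seq X) : path adj x p ->
  exists2 q, [/\ path adj x q, uniq (x :: q) & last x q = last x p]
           & (size q <= size p)%N.
Proof.
move=> /shortenP[q xq uq sub]; exists q => //.
by apply: uniq_leq_size => //; case/andP: uq.
Qed.

(* Along any edge of a tree, one of the two canonical paths extends the
   other; the covering map below uses nothing else about trees. *)
Lemma tree_canonical_paths (v : X) :
  graph_connected adj -> graph_acyclic adj ->
  exists P : X -> seq X, P v = [::] /\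
    (forall x, path adj v (P x) /\ last v (P x) = x) /\
    (forall x y, adj x y -> P y = rcons (P x) y \/ P x = rcons (P y) x).
Proof.
move=> conn acyc.
have /choice[P PE] x : exists p,
    [/\ path adj v p, uniq (v :: p) & last v p = x].
  by have [s vs lx] := conn v x; have [q] := shorten_walk vs; exists q; rewrite -lx.
exists P; split.
  have [_ + lv] := PE v; case: (P v) lv => // a s /= lv /andP[/negP[]].
  by rewrite -{1}lv mem_last.
split=> [x|x y xy]; first by case: (PE x).
have [px ux lx] := PE x; have [py uy ly] := PE y.
have [yin|ynin] := boolP (y \in v :: P x); last first.
  left; apply: (acyclic_uniq_path (v := v)) => //.
  - by rewrite rcons_path px lx.
  - by rewrite -rcons_cons rcons_uniq ynin.
  - by rewrite last_rcons.
(* The stretch of the path from [y] to [x], closed by the edge between them, is a [ucycle]; its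
   length bound forces [s2] to be a single node. *)
right; case/splitPl: yin px ux lx => s1 s2 ls1.
rewrite cat_path last_cat ls1 => /andP[vs1 ys2].
rewrite -cat_cons cat_uniq => /and3P[us1 /hasPn dis us2] ls2.
have -> : P y = s1 by apply: (acyclic_uniq_path (v := v)) => //; rewrite ls1.
have /acyc : ucycle adj (y :: s2).
  rewrite /ucycle /= rcons_path ys2 ls2 xy /= us2 andbT.
  by apply/negP => /dis; rewrite -ls1 mem_last.
case: s2 ys2 ls2 {dis us2} => [_ yx|z [|//] _ /= ->]; last by rewrite cats1.
by move: xy; rewrite -yx /= adj_irr.
Qed.

End ReducedWalks.

(** * Covering maps from a tree *)

Definition local_bijection (X Y : eqType) (adjX : rel X) (adjY : rel Y)
    (x : X) (y : Y) (f : X -> Y) : Prop :=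
  [/\ forall z, adjX x z -> adjY y (f z),
      forall z z', adjX x z -> adjX x z' -> f z = f z' -> z = z'
    & forall w, adjY y w -> exists2 z, adjX x z & f z = w].

Section CoveringMap.
Variables (X Y : eqType) (I : Type) (adjX : rel X) (adjY : rel Y).
Variables (tX : X -> I) (tY : Y -> I).
Hypotheses (symX : symmetric adjX) (irrX : irreflexive adjX).
Hypothesis symY : symmetric adjY.
Hypothesis matching : forall x y, tX x = tY y ->
  exists2 f, local_bijection adjX adjY x y f
           & forall z, adjX x z -> tY (f z) = tX z.

(** Composing a matching with the transposition of [q] and [f p], which have the same type, makes it
    respect the image [q] already given to the predecessor [p] of [x]. *)
Lemma matching_through (x p : X) (y q : Y) : tX x = tY y ->
  exists f, [/\ local_bijection adjX adjY x y f,
    forall z, adjX x z -> tY (f z) = tX z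
    & adjX x p -> adjY y q -> tX p = tY q -> f p = q].
Proof.
move=> /matching[f [f1 f2 f3] f4].
have [[xp [yq tpq]]|nxp] := pselect (adjX x p /\ adjY y q /\ tX p = tY q);
  last first.
  by exists f; split=> // ? ? ?; exfalso; apply: nxp.
pose g z := if z == p then q else if f z == q then f p else f z.
have [p' xp' fp'] := f3 q yq.
exists g; split; last by rewrite /g eqxx.
- split=> [z xz|z z' xz xz'|w yw]; rewrite /g.
  + by case: ifP => // _; case: ifP => _; apply: f1.
  + case: (eqVneq z p) => [->|zp]; case: (eqVneq z' p) => [->|z'p] //.
    * case: (eqVneq (f z') q) => [fz'|nfz'].
      -- by move=> qfp; case/eqP: z'p; apply: f2 => //; rewrite fz'.
      -- by move=> qfz; rewrite -qfz eqxx in nfz'.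
    * case: (eqVneq (f z) q) => [fz|nfz].
      -- by move=> qfp; case/eqP: zp; apply: f2 => //; rewrite fz.
      -- by move=> qfz; rewrite qfz eqxx in nfz.
    * case: (eqVneq (f z) q) => [fz|nfz]; case: (eqVneq (f z') q) => [fz'|nfz'].
      -- by move=> _; apply: f2 => //; rewrite fz.
      -- by move=> e; case/eqP: z'p; apply: f2.
      -- by move=> e; case/eqP: zp; apply: f2.
      -- exact: f2.
  + have [->|wq] := eqVneq w q; first by exists p; rewrite ?eqxx.
    have [z xz fz] := f3 w yw.
    have [wfp|nwfp] := eqVneq w (f p).
      exists p' => //; case: (eqVneq p' p) => [p'p|p'p].
        by move: wq; rewrite wfp -p'p fp' eqxx.
      by rewrite fp' eqxx.
    exists z => //; case: (eqVneq z p) => [zp|_].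
      by move: nwfp; rewrite -fz zp eqxx.
    by rewrite fz (negbTE wq).
- move=> z xz; rewrite /g; case: (eqVneq z p) => [->//|zp].
  case: (eqVneq (f z) q) => [fzq|_]; last exact: f4.
  by rewrite f4 // tpq -fzq f4.
Qed.

(** The image of [x] is found by following its canonical path from [v], each step using a matching
    that sends the previous node back to its own image. *)
Lemma covering_map (v : X) (u : Y) :
  graph_connected adjX -> graph_acyclic adjX -> tX v = tY u ->
  exists f : X -> Y, [/\ f v = u, forall x, tY (f x) = tX x
    & forall x, local_bijection adjX adjY x (f x) f].
Proof.
move=> conn acyc tvu.
have [P [Pv [P1 P2]]] := tree_canonical_paths symX irrX v conn acyc.
have /choice[phi phiP] (a : (X * X) * (Y * Y)) : exists f,
    tX a.1.1 = tY a.2.1 ->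
    [/\ local_bijection adjX adjY a.1.1 a.2.1 f,
    forall z, adjX a.1.1 z -> tY (f z) = tX z
    & adjX a.1.1 a.1.2 -> adjY a.2.1 a.2.2 -> tX a.1.2 = tY a.2.2 ->
      f a.1.2 = a.2.2].
  have [t|nt] := pselect (tX a.1.1 = tY a.2.1); last by exists (fun=> u).
  by have [f ?] := matching_through a.1.2 a.2.2 t; exists f.
(* A state holds the current and previous node of the walk and their images. *)
pose step (a : (X * X) * (Y * Y)) y := ((y, a.1.1), (phi a y, a.2.1)).
(* The root has no previous node; [v] stands in for it, and since [v] is not adjacent to itself the
   last clause of [phiP] is vacuous there. *)
pose st s := foldl step ((v, v), (u, u)) s.
have stx s : (st s).1.1 = last v s.
  by case/lastP: s => // s y; rewrite /st foldl_rcons last_rcons.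
have stt s : path adjX v s -> tX (st s).1.1 = tY (st s).2.1.
  elim/last_ind: s => // s y IHs; rewrite rcons_path => /andP[/IHs t ly].
  rewrite /st foldl_rcons -/(st s) /=.
  by have [_ -> //] := phiP _ t; rewrite stx.
pose f x := (st (P x)).2.1.
have fP x : tX x = tY (f x).
  by have [vP lP] := P1 x; rewrite -stt // stx lP.
have x11 x : (st (P x)).1.1 = x by have [_ lP] := P1 x; rewrite stx lP.
have phif x y : adjX x y -> phi (st (P x)) y = f y.
  move=> xy; have [|] := P2 _ _ xy.
    by move=> Py; rewrite /f Py /st foldl_rcons.
  (* Here [y] precedes [x] on the canonical path, so the matching at [x] was chosen to send [y] back
     to [f y]. *)
  move=> Pxy.
  have tx := stt _ (P1 x).1; have ty := stt _ (P1 y).1.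
  have [_ _] := phiP _ tx.
  have -> : st (P x) = ((x, y), (phi (st (P y)) x, f y)).
    by rewrite Pxy /st foldl_rcons -/(st _) /step x11.
  apply=> //=; rewrite symY.
  have [[+ _ _] _ _] := phiP _ ty; apply.
  by rewrite x11 symX.
exists f; split=> // [|x]; first by rewrite /f Pv.
have [[fx1 fx2 fx3] _ _] := phiP _ (stt _ (P1 x).1).
rewrite x11 in fx1 fx2 fx3; split.
- by move=> z xz; rewrite -(phif x z) //; apply: fx1.
- by move=> z z' xz xz'; rewrite -(phif x z) // -(phif x z') //; apply: fx2.
- by move=> w /fx3[z xz fz]; exists z; rewrite -?(phif x z).
Qed.

End CoveringMap.

Section CoveringInjective.
Variables (X Y : eqType) (adjX : rel X) (adjY : rel Y) (f : X -> Y).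
Hypothesis symX : symmetric adjX.
Hypothesis covf : forall x, local_bijection adjX adjY x (f x) f.

(** A backtrack in the image would identify two neighbours of one node, against local
    injectivity. *)
Lemma covering_reduced (s : seq X) :
  sorted adjX s -> reduced s -> reduced (map f s).
Proof.
elim: s => // x s IHs xs /= /andP[rx rs].
rewrite IHs // ?(path_sorted xs) // andbT.
case: s xs rx {IHs rs} => [|y [|z s]] //= /and3P[xy yz _].
apply: contra => /eqP fxz; apply/eqP.
by have [_ + _] := covf y; apply; rewrite // symX.
Qed.

Lemma covering_injective_short (L : nat) (x : X) (s : seq X) :
  girth_gt adjY L -> path adjX x s -> (size s <= L)%N ->
  f (last x s) = f x -> last x s = x.
Proof.
move=> gir /shorten_walk[q [xq uq <-] /leq_trans qs] /qs{qs} qL fl.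
case: q => // a q in xq uq qL fl *.
have fp : path adjY (f x) (map f (a :: q)).
  by apply: homo_path xq => y z yz; have [+ _ _] := covf y; apply.
have fr : reduced (f x :: map f (a :: q)).
  by rewrite -map_cons; apply: covering_reduced => //; apply: uniq_reduced.
by have := gir _ _ fp fr; rewrite last_map fl eqxx size_map qL => /(_ isT).
Qed.

End CoveringInjective.

(** * Matching neighbours of equal types *)

Section Matching.
Variables (X Y : choiceType).

Lemma set_bijection_of_card (A : set X) (B : set Y) (n : nat) (y0 : Y) :
  A #= `I_n -> B #= `I_n -> exists2 f : X -> Y, set_inj A f & f @` A = B.
Proof.
move=> An Bn; have : A #= B by apply: card_eq_trans An _; rewrite card_eq_sym.
move=> /ocard_eqP[f]; have fin x : A x -> (some @` B) (f x) by apply: funS.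
exists (fun x => odflt y0 (f x)) => [x x' /set_mem Ax /set_mem Ax'|].
  have [y By fx] := fin _ Ax; have [y' By' fx'] := fin _ Ax'.
  rewrite -fx -fx' /= => yy'; apply: (@inj _ _ _ f); rewrite ?inE //.
  by apply: etrans (etrans (esym fx) _) fx'; rewrite yy'.
apply/seteqP; split=> [_ [x /fin[y By /= <-] <-]//|y By].
have [x Ax fx] : (f @` A) (Some y) by rewrite image_eq; exists y.
by exists x; rewrite // fx.
Qed.

(* Types on both sides are matched one at a time and the bijections glued. *)
Lemma matching_of_typed_degrees (I : eqType) (adjX : rel X) (adjY : rel Y)
    (tX : X -> I) (tY : Y -> I) (x : X) (y : Y) (m : I -> nat) :
  (forall b, [set z | adjX x z /\ tX z = b] #= `I_(m b)) ->
  (forall b, [set z | adjY y z /\ tY z = b] #= `I_(m b)) ->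
  exists2 f, local_bijection adjX adjY x y f
           & forall z, adjX x z -> tY (f z) = tX z.
Proof.
move=> dX dY.
have /choice[g gP] b : exists g : X -> Y,
    set_inj [set z | adjX x z /\ tX z = b] g /\
    g @` [set z | adjX x z /\ tX z = b] = [set z | adjY y z /\ tY z = b].
  by have [g g1 g2] := set_bijection_of_card y (dX b) (dY b); exists g.
have gin z : adjX x z -> adjY y (g (tX z) z) /\ tY (g (tX z) z) = tX z.
  move=> xz; have [_ /seteqP[+ _]] := gP (tX z).
  by move=> /(_ (g (tX z) z)); apply; exists z.
exists (fun z => g (tX z) z); last by move=> z /gin[].
split=> [z /gin[]//|z z' xz xz' e|w yw].
- have tzz' : tX z = tX z'.
    by have [_ <-] := gin _ xz; rewrite e; have [_ ->] := gin _ xz'.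
  have [+ _] := gP (tX z); apply; rewrite ?inE //.
  by rewrite e tzz'.
- have [_ /seteqP[_ +]] := gP (tY w).
  by move=> /(_ w (conj yw erefl))[z [xz tz] <-]; exists z; rewrite ?tz.
Qed.

End Matching.

(** * Rooted balls and their isomorphisms *)

Lemma set_type_image_preimage (V : choiceType) (A e : set V) :
  e `<=` A -> val @` ((val : set_type A -> V) @^-1` e) = e.
Proof.
move=> eA; apply/seteqP; split=> [_ [x ex <-]//|x ex].
by exists (exist _ x (mem_set (eA x ex))).
Qed.

Lemma image_set_inj (X Y : Type) (f : X -> Y) (A B : set X) :
  injective f -> f @` A = f @` B -> A = B.
Proof.
move=> fI fAB; apply/seteqP; split=> x; rewrite -(image_inj (A := A) fI) fAB;
  by rewrite image_inj.
Qed.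

Section BallIsomorphism.
Variables (tv te t : nat) (V W : choiceType).

(** [nbhd_iso] without subtypes: [g] is defined on all vertices, but only its values on the ball
    matter. *)
Record ball_iso (H : typed_hypergraph tv te V) (r : V)
    (H' : typed_hypergraph tv te W) (r' : W) (g : V -> W) : Prop := BallIso {
  ball_iso_root : g r = r';
  ball_iso_inj : {in nbhd_set H t r &, injective g};
  ball_iso_image : g @` nbhd_set H t r = nbhd_set H' t r';
  ball_iso_vtype : forall v, nbhd_set H t r v -> vtype H' (g v) = vtype H v;
  ball_iso_edge : forall e, e `<=` nbhd_set H t r -> hyperedges H e ->
    hyperedges H' (g @` e) /\ etype H' (g @` e) = etype H e;
  ball_iso_edge_surj : forall e', e' `<=` nbhd_set H' t r' ->
    hyperedges H' e' -> exists e, [/\ e `<=` nbhd_set H t r, hyperedges H e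
                                    & g @` e = e']
}.

Lemma nbhd_iso_of_ball_iso (H : typed_hypergraph tv te V) (r : V)
    (H' : typed_hypergraph tv te W) (r' : W) (g : V -> W) :
  ball_iso H r H' r' g -> nbhd_iso t H r H' r'.
Proof.
case=> gr gI gim gv ge gs.
have gN (x : set_type (nbhd_set H t r)) : g (val x) \in nbhd_set H' t r'.
  by rewrite inE -gim; exists (val x) => //; apply/set_mem/valP.
pose f x : set_type (nbhd_set H' t r') := exist _ (g (val x)) (gN x).
have vf e : val @` (f @` e) = g @` (val @` e) by rewrite !image_comp.
exists f; split.
- rewrite -setTT_bijective; split => // [x y _ _ /(congr1 val) /= gxy|y _].
    by apply: val_inj; apply: gI => //; apply: valP.
  have [x Nx gx] : (g @` nbhd_set H t r) (val y).
    by rewrite gim; apply/set_mem/valP.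
  by exists (exist _ x (mem_set Nx)) => //; apply: val_inj.
- exact: val_inj.
- apply/seteqP; split=> [_ [e /= He <-]|e' /= He'].
    have [] := ge _ _ He; first by move=> _ [x _ <-]; apply/set_mem/valP.
    by rewrite /= vf.
  have [||e [eN He gee']] := gs (val @` e') => //.
    by move=> _ [x _ <-]; apply/set_mem/valP.
  exists (val @^-1` e); first by rewrite /= set_type_image_preimage.
  apply: (image_set_inj val_inj).
  by rewrite vf set_type_image_preimage.
- by move=> x; apply/gv/set_mem/valP.
- move=> e He; have [] := ge _ _ He; last by rewrite /= vf.
  by move=> _ [x _ <-]; apply/set_mem/valP.
Qed.

Lemma ball_iso_of_nbhd_iso (H : typed_hypergraph tv te V) (r : V)
    (H' : typed_hypergraph tv te W) (r' : W) :
  nbhd_iso t H r H' r' -> exists g, ball_iso H r H' r' g.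
Proof.
case=> f [fbij fr fe fv fet].
pose g x := if pselect (x \in nbhd_set H t r) is left p
            then val (f (exist _ x p)) else r'.
have gf (x : set_type (nbhd_set H t r)) : g (val x) = val (f x).
  rewrite /g; case: pselect => [p|[]]; last exact: valP.
  by congr (val (f _)); apply: val_inj.
have vf e : val @` (f @` e) = g @` (val @` e).
  by rewrite !image_comp; apply: eq_imagel => x _; rewrite /= gf.
exists g; split.
- by rewrite -[r]/(val (nbhd_root H t r)) gf fr.
- move=> x y xN yN; rewrite -[x]/(val (exist _ x xN)) -[y]/(val (exist _ y yN)).
  by rewrite !gf => /val_inj /(bij_inj fbij) ->.
- apply/seteqP; split=> [_ [x Nx <-]|y Ny].
    by rewrite -[x]/(val (exist _ x (mem_set Nx))) gf; apply/set_mem/valP.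
  have [f' f'K fK] := fbij; pose y' := exist _ y (mem_set Ny) : set_type _.
  exists (val (f' y')); first exact/set_mem/valP.
  by rewrite gf fK.
- by move=> v Nv; rewrite -[v]/(val (exist _ v (mem_set Nv))) gf [LHS]fv.
- move=> e eN He; rewrite -[e in g @` e](set_type_image_preimage eN) -vf.
  have He' : hyperedges (nbhd H t r) (val @^-1` e).
    by rewrite /= set_type_image_preimage.
  split; last by have /= := fet _ He'; rewrite set_type_image_preimage.
  have : hyperedges (nbhd H' t r') (f @` (val @^-1` e)) by rewrite -fe; exists (val @^-1` e).
  by [].
- move=> e' e'N He'.
  have : hyperedges (nbhd H' t r') (val @^-1` e').
    by rewrite /= set_type_image_preimage.
  rewrite -fe => -[e /= He ee'].
  exists (val @` e); split=> //; first by move=> _ [x _ <-]; apply/set_mem/valP.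
  by rewrite -vf ee' set_type_image_preimage.
Qed.

End BallIsomorphism.

Lemma nbhd_iso_sym (tv te t : nat) (V W : choiceType)
    (H : typed_hypergraph tv te V) (r : V)
    (H' : typed_hypergraph tv te W) (r' : W) :
  nbhd_iso t H r H' r' -> nbhd_iso t H' r' H r.
Proof.
case=> f [[f' f'K fK] fr fe fv fet].
have fim e : f' @` (f @` e) = e.
  by rewrite image_comp (eq_imagel (f' := id)) ?image_id // => x _ /=.
exists f'; split.
- by exists f.
- by rewrite -fr f'K.
- rewrite -fe; apply/seteqP; split=> [_ [_ [e He <-] <-]|e He]; first by rewrite fim.
  by exists (f @` e); [exists e | rewrite fim].
- by move=> v; rewrite -fv fK.
- by move=> e'; rewrite -fe => -[e He <-]; rewrite fim fet.
Qed.

Section DistLe.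
Variables (X : eqType) (adj : rel X).

Lemma dist_le_trans (s t : nat) (x y z : X) :
  dist_le adj s x y -> dist_le adj t y z -> dist_le adj (s + t) x z.
Proof.
case=> p [xp lp sp] [q [yq lq sq]]; exists (p ++ q).
by rewrite cat_path last_cat xp lp size_cat leq_add.
Qed.

Lemma dist_le_sym (t : nat) (x y : X) : symmetric adj ->
  dist_le adj t x y -> dist_le adj t y x.
Proof.
move=> sym [p [xp <- sp]]; exists (rev (belast x p)).
rewrite rev_path size_rev size_belast; split=> //.
- by apply: sub_path xp => u v; rewrite sym.
- by case: p {xp sp} => // a p; rewrite /= rev_cons last_rcons.
Qed.

Lemma dist_le1 (x y : X) : adj x y -> dist_le adj 1 x y.
Proof. by move=> xy; exists [:: y]; rewrite /= xy. Qed.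

End DistLe.

(** * Typed incidence graphs *)

Section Incidence.
Variables (tv te : nat) (V : choiceType) (H : typed_hypergraph tv te V).

Definition incidence_type (x : V + set_type (hyperedges H)) : 'I_tv + 'I_te :=
  match x with inl v => inl (vtype H v) | inr e => inr (etype H (val e)) end.

(** Both matrices as a single degree function on node types, the form in which
    [matching_of_typed_degrees] takes them. *)
Definition branching (D : 'M[nat]_(tv, te)) (K : 'M[nat]_(te, tv))
    (a b : 'I_tv + 'I_te) : nat :=
  match a, b with
  | inl i, inr j => D i j
  | inr j, inl i => K j i
  | _, _ => 0
  end.

Lemma incidence_adj_sym : symmetric (@incidence_adj V H).
Proof. by move=> [v|e] [w|f]. Qed.

Lemma incidence_adj_irr : irreflexive (@incidence_adj V H).
Proof. by move=> [v|e]. Qed.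

Lemma vertex_adj_sym : symmetric (vertex_adj H).
Proof. by move=> u v; apply/asbool_equiv_eq; split=> -[e He []]; exists e. Qed.

Lemma incidence_degrees (D : 'M[nat]_(tv, te)) (K : 'M[nat]_(te, tv))
    (x : V + set_type (hyperedges H)) (b : 'I_tv + 'I_te) :
  branching_matrices H D K ->
  [set y | incidence_adj x y /\ incidence_type y = b]
    #= `I_(branching D K (incidence_type x) b).
Proof.
move=> [HD HK]; case: x => [v|e]; case: b => [i|j] /=.
- by rewrite II0 card_eq0; apply/eqP/seteqP; split=> // -[w|f] [].
- apply: card_eq_trans (HD v j).
  pose F (y : V + set_type (hyperedges H)) := if y is inr e then val e else set0.
  set A := mkset _; set B := mkset _.
  have <- : F @` A = B.
    apply/seteqP; split=> [_ [[w|e] []//= ve [tj] <-]|e [He ev tj]].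
      by split=> //; apply/set_mem => //; apply: valP.
    by exists (inr (exist _ e (mem_set He))) => //; split; rewrite /= ?tj ?inE.
  rewrite card_eq_sym; apply: inj_card_eq => -[w|f] [w'|f'] //;
    rewrite !inE /A /=; try by move=> [] // ? ? [].
  by move=> _ _ ff'; congr inr; apply: val_inj.
- apply: card_eq_trans (HK (val e) i (set_mem (valP e))).
  pose F (y : V + set_type (hyperedges H)) := if y is inl w then Some w else None.
  set A := mkset _; set B := mkset _.
  have <- : (@inl V (set_type (hyperedges H))) @` B = A.
    apply/seteqP; split=> [_ [w [ew tw] <-]|[w|f] []//= ew [tw]].
      by split; rewrite /= ?inE ?tw.
    by exists w => //; split=> //; apply/set_mem.
  by apply: inj_card_eq => w w' _ _ [].
- by rewrite II0 card_eq0; apply/eqP/seteqP; split=> // -[w|f] [].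
Qed.

Lemma dist_le_incidence (t : nat) (x y : V) : dist_le (vertex_adj H) t x y ->
  dist_le (@incidence_adj V H) t.*2 (inl x) (inl y).
Proof.
elim: t x => [|t IHt] x [[|z s] [] //=].
- by move=> _ <- _; exists [::].
- by move=> _ <- _; exists [::].
move=> /andP[/asboolP[e He [ex ez]] zs] lz st.
have [p [p1 p2 p3]] : dist_le (@incidence_adj V H) t.*2 (inl z) (inl y).
  by apply: IHt; exists s.
exists [:: inr (exist _ e (mem_set He)), inl z & p] => /=.
by rewrite p1 p2 !ltnS; split=> //; rewrite andbT; apply/andP; rewrite !inE.
Qed.

End Incidence.

(** * Balls in a hypergraph of large girth with the degrees of the tree *)

Section CoveringBallIso.
Variables (tv te : nat) (V W : choiceType).
Variables (T : typed_hypergraph tv te V) (h : typed_hypergraph tv te W).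
Variables (D : 'M[nat]_(tv, te)) (K : 'M[nat]_(te, tv)).
Hypotheses (treeT : is_tree (@incidence_adj V T)).
Hypotheses (brT : branching_matrices T D K) (brh : branching_matrices h D K).
Hypothesis nonempty_h : forall e, hyperedges h e -> e !=set0.

(* The universal cover of the incidence graph of [h] is the tree [T]; a
   covering map is injective on balls of radius less than half the girth. *)
Lemma nbhd_iso_of_girth (t : nat) (v : V) (u : W) :
  girth_gt (@incidence_adj W h) (t.*2.*2 + 4)%N -> vtype T v = vtype h u ->
  nbhd_iso t h u T v.
Proof.
move=> girth tvu; apply/nbhd_iso_sym.
have [_ conn acyc] := treeT.
have match_ x y : incidence_type x = incidence_type y ->
    exists2 f, local_bijection (@incidence_adj V T) (@incidence_adj W h) x y f
    & forall z, incidence_adj x z -> incidence_type (f z) = incidence_type z.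
  move=> txy; apply: (matching_of_typed_degrees
    (m := branching D K (incidence_type x))) => b.
  - exact: incidence_degrees.
  - by rewrite txy; apply: incidence_degrees.
have [|f [fvu ft floc]] := covering_map (@incidence_adj_sym _ _ _ T)
  (@incidence_adj_irr _ _ _ T) (@incidence_adj_sym _ _ _ h) match_
  (v := inl v) (u := inl u) conn acyc; first by rewrite /= tvu.
pose g x := if f (inl x) is inl y then y else u.
have fg x : f (inl x) = inl (g x).
  by have := ft (inl x); rewrite /g; case: (f _).
have gt x : vtype h (g x) = vtype T x.
  by have := ft (inl x); rewrite fg => -[].
have edge e (He : hyperedges T e) :
    hyperedges h (g @` e) /\ etype h (g @` e) = etype T e.
  pose e1 : set_type (hyperedges T) := exist _ e (mem_set He).
  have [f1 _ f3] := floc (inr e1); have := ft (inr e1).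
  case E : (f (inr e1)) f1 f3 => [//|e2] f1 f3 [te12].
  suff -> : g @` e = val e2 by split=> //; apply/set_mem/valP.
  apply/seteqP; split=> [_ [x ex <-]|y ey].
    by have := f1 (inl x); rewrite fg /= !inE; apply.
  have [|[x|//]] := f3 (inl y); rewrite /= ?inE //.
  by rewrite fg => ex [<-]; exists x.
have lift_edge x e' : hyperedges h e' -> e' (g x) ->
    exists e, [/\ hyperedges T e, e x & g @` e = e'].
  move=> He' ex; have [_ _ f3] := floc (inl x).
  have [|[//|e1]] := f3 (inr (exist _ e' (mem_set He'))).
    by rewrite fg /= inE.
  rewrite /= => xe fe1; exists (val e1).
  split; [exact/set_mem/valP|exact/set_mem|].
  have [f1 _ f3'] := floc (inr e1); rewrite fe1 in f1 f3'.
  apply/seteqP; split=> [_ [z ez <-]|y ey].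
    by have := f1 (inl z); rewrite fg /= !inE; apply.
  have [|[z|//]] := f3' (inl y); rewrite /= ?inE //.
  by rewrite fg => ez [<-]; exists z.
have gadj x y : vertex_adj T x y -> vertex_adj h (g x) (g y).
  move=> /asboolP[e /edge[He _] [ex ey]]; apply/asboolP.
  by exists (g @` e).
have gdist s x y : dist_le (vertex_adj T) s x y ->
    dist_le (vertex_adj h) s (g x) (g y).
  move=> [p [xp <- sp]]; exists (map g p); rewrite last_map size_map.
  by split=> //; apply: homo_path xp => *; apply: gadj.
have glift s x y' : dist_le (vertex_adj h) s (g x) y' ->
    exists2 y, dist_le (vertex_adj T) s x y & g y = y'.
  move=> [p [xp <- sp]]; elim: p s x xp sp => [|z p IHp] [//|s] x /=.
  - by exists x => //; exists [::].
  - by exists x => //; exists [::].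
  move=> /andP[/asboolP[e He [ex ez]] zp] ps.
  have [e0 [He0 e0x e0e]] := lift_edge x e He ex.
  have [z0 e0z0 gz0] : (g @` e0) z by rewrite e0e.
  rewrite -gz0 in zp *.
  have [y yd <-] := IHp s z0 zp ps.
  exists y => //; rewrite -add1n; apply: dist_le_trans yd.
  by apply: dist_le1; apply/asboolP; exists e0.
(* Injectivity is needed below up to distance 2t+1; a step between vertices is two incidences, so
   girth beyond 4t+4 is ample. *)
have ginj s x y : dist_le (vertex_adj T) s x y -> (s <= t.*2.+2)%N ->
    g x = g y -> x = y.
  move=> /dist_le_incidence[p [xp lp sp]] st gxy.
  have := covering_injective_short (@incidence_adj_sym _ _ _ T) floc girth xp.
  rewrite lp !fg gxy => inj_xy; have spt : (size p <= t.*2.*2 + 4)%N by lia.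
  by case: (inj_xy spt erefl).
have vsym := @vertex_adj_sym _ _ _ T.
have guv : g v = u by have := fvu; rewrite fg => -[].
apply: (@nbhd_iso_of_ball_iso _ _ _ _ _ _ _ _ _ g); split=> //.
- move=> x y /set_mem Nx /set_mem Ny; apply: (ginj (t + t)%N); last lia.
  by apply: dist_le_trans Ny; apply: dist_le_sym.
- apply/seteqP; split=> [_ [x Nx <-]|y Ny]; first by rewrite -guv; apply: gdist.
  by have [|x] := glift t v y; [rewrite guv | exists x].
- by move=> e _; apply: edge.
(* The lift [e] of [e'] through a vertex [y] of the ball must lie in the ball. Each [x] in [e] has
   the same image as some [x0] of the ball, and their distance is at most t + t + 1, so they
   coincide. *)
- move=> e' e'N He'; have [y' ey'] := nonempty_h He'.
  have [|y Ny gy] := glift t v y'; first by rewrite guv; apply: e'N.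
  have [|e [He ey gee]] := lift_edge y e' He'; first by rewrite gy.
  exists e; split=> // x ex.
  have [|x0 Nx0 gx0] := glift t v (g x).
    by rewrite guv; apply: e'N; rewrite -gee; exists x.
  suff -> : x = x0 by [].
  apply: (ginj (t + t + 1)%N); [|lia|by rewrite gx0].
  rewrite addnC; apply: (@dist_le_trans _ _ _ _ _ y).
    by apply: dist_le1; apply/asboolP; exists e.
  by apply: dist_le_trans Nx0; apply: dist_le_sym.
Qed.

End CoveringBallIso.

(** * Involutions acting on reduced words *)

Section WordAction.
Variables (S : finType) (L : nat).

(** Left multiplication by a generator in the free product of groups of order 2, truncated: a full
    word that does not begin with [s] is fixed. *)
Definition flip (s : S) (w : seq S) : seq S :=
  if ohead w == Some s then behead w else if (size w < L)%N then s :: w else w.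

Definition no_repeat (w : seq S) : bool := sorted (fun a b => a != b) w.

Lemma no_repeat_flip (s : S) (w : seq S) : no_repeat w -> no_repeat (flip s w).
Proof.
rewrite /flip; case: eqVneq => [_|]; first by case: w => // a w /path_sorted.
case: ifP => // _; case: w => //= a w; rewrite /no_repeat /= => sa ->.
by rewrite andbT; apply: contra sa => /eqP->.
Qed.

Lemma size_flip (s : S) (w : seq S) :
  (size w <= L)%N -> (size (flip s w) <= L)%N.
Proof.
by rewrite /flip; case: ifP => [_|_]; [case: w => //= a w /ltnW | case: ifP].
Qed.

(** Cancelling is reversible because the letter behind a leading [s] is not [s], so the second flip
    prepends. *)
Lemma flipK (s : S) (w : seq S) : no_repeat w -> (size w <= L)%N ->
  flip s (flip s w) = w.
Proof.
move=> rw sw; rewrite {2}/flip; case: eqVneq => [|ws].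
  case: w rw sw => [//|a w] /= rw sw [as_]; subst a; rewrite /flip sw.
  case: eqVneq => // ws; case: w ws rw {sw} => //= b w [->].
  by rewrite /no_repeat /= eqxx.
case: ifP => wL; first by rewrite /flip /= eqxx.
by rewrite /flip (negbTE ws) wL.
Qed.

Definition word : finType := {w : L.-bseq S | no_repeat w}.

Definition word_seq (a : word) : seq S := val (val a).

Definition word_flip (s : S) (w : word) : word :=
  Sub (Bseq (size_flip s (size_bseq (val w))))
      (no_repeat_flip s (valP w)).

Lemma word_flipK (s : S) : involutive (word_flip s).
Proof.
move=> w; do 2 apply: val_inj.
by rewrite /= flipK ?size_bseq //; exact: (valP w).
Qed.

Definition word_perm (s : S) : {perm word} := perm (inv_inj (word_flipK s)).

Local Open Scope group_scope.

Lemma word_permK (g : {perm word}) (s : S) : g * word_perm s * word_perm s = g.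
Proof. by apply/permP => w; rewrite !permM !permE word_flipK. Qed.

Lemma val_foldl_word_perm (g : {perm word}) (w : seq S) (a : word) :
  foldl (fun g s => g * word_perm s) g w a = foldl (fun b s => word_flip s b) (g a) w.
Proof. by elim: w g => //= s w IHw g; rewrite IHw permM permE. Qed.

Lemma foldl_word_flip (a : word) (w : seq S) :
  no_repeat w -> ohead w != ohead (word_seq a) \/ w = [::] ->
  (size w + size (word_seq a) <= L)%N ->
  word_seq (foldl (fun b s => word_flip s b) a w) = catrev w (word_seq a).
Proof.
elim: w a => //= s w IHw a rw [|//] sa swa.
have fa : word_seq (word_flip s a) = s :: word_seq a.
  rewrite /word_seq /= -/(word_seq a) /flip eq_sym (negbTE sa) ifT //.
  by lia.
rewrite IHw ?fa //=.
- exact: path_sorted rw.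
- case: w rw {IHw swa} => [|b w]; first by right.
  by rewrite /no_repeat /= => /andP[sb _]; left; apply: contra sb => /eqP[->].
- by rewrite addnS.
Qed.

(* Acting on the empty word, the product spells out the word. *)
Lemma word_perm_no_relation (g : {perm word}) (w : seq S) :
  no_repeat w -> (0 < size w <= L)%N ->
  foldl (fun g s => g * word_perm s) g w <> g.
Proof.
move=> rw /andP[w0 wL] /permP gw.
pose e : word := Sub (Bseq (leq0n L : (size [::] <= L)%N)) isT.
(* Permutations compose from left to right, so [g] acts first; at [g^-1 e] the letters start from
   the empty word. *)
have := gw (g^-1 e); rewrite val_foldl_word_perm permKV.
move=> /(congr1 (fun a : word => size (word_seq a))).
rewrite foldl_word_flip ?addn0 //; last by case: w w0 {rw wL gw}; left.
by rewrite catrevE cats0 size_rev /=; case: (size w) w0.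
Qed.

Lemma word_perm_inj (g : {perm word}) (s s' : S) : (2 <= L)%N ->
  g * word_perm s = g * word_perm s' -> s = s'.
Proof.
move=> L2 e; apply: contrapT => ss'.
apply: (@word_perm_no_relation g [:: s; s']) => //=.
- by rewrite /no_repeat /= andbT; apply/eqP.
- by rewrite e word_permK.
Qed.

(** The colours along a walk spell a word. A colour and one end determine the other end, so two
    equal successive colours would be a backtrack; a closed reduced walk thus gives a relation
    without repeats, which is longer than [L]. *)
Lemma girth_of_edge_coloring (N : eqType) (adj : rel N) (E : S -> N -> N -> Prop)
    (gam : N -> {perm word}) :
  (forall x z, adj x z -> exists s, E s x z) ->
  (forall s x z, E s x z -> E s z x) ->
  (forall s x z z', E s x z -> E s x z' -> z = z') ->
  (forall s x z, E s x z -> gam z = gam x * word_perm s) ->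
  girth_gt adj L.
Proof.
move=> adjE Esym Edet Egam x p xp rp sp; apply/eqP => lx.
have [w [sw rw gw _]] : exists w, [/\ size w = size p, no_repeat w,
    gam (last x p) = foldl (fun g s => g * word_perm s) (gam x) w
    (* This clause keeps the colour of the first edge, to compare it with the edge prepended in the
       induction. *)
    & forall z p', p = z :: p' -> exists s w', w = s :: w' /\ E s x z].
  elim: p x xp rp {sp lx} => [|z p IHp] x /=; first by exists [::].
  move=> /andP[/adjE[s sxz] zp] /andP[xz rp].
  have [w [sw rw gw hw]] := IHp z zp rp.
  exists (s :: w); rewrite /= sw gw (Egam _ _ _ sxz); split=> //; last first.
    by move=> _ _ [<- _]; exists s, w.
  case: p xz {IHp zp rp} sw hw gw => [|z' p] xz sw hw _; first by case: w sw {rw hw}.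
  have [s' [w' [ww' szz']]] := hw _ _ erefl.
  rewrite /no_repeat ww' /= -[path _ _ _]/(no_repeat (s' :: w')) -ww' rw andbT.
  apply: contra xz => /eqP ss'; apply/eqP.
  by apply: (Edet s z); [exact: Esym | rewrite ss'].
by apply: (@word_perm_no_relation (gam x) w) => //; rewrite ?sw // -gw lx.
Qed.

End WordAction.

(** * Finite multigraphs with prescribed degrees *)

Lemma card_finset (U : finType) (A : {set U}) : [set` A] #= `I_#|A|.
Proof.
have [f fI fA] : exists2 f : U -> nat, {in [set` A] &, injective f}
    & f @` [set` A] = `I_#|A|.
  exists (fun x => index x (enum A)).
    move=> x y /set_mem xA /set_mem yA exy.
    by rewrite -(nth_index x (s := enum A) (x := x)) ?mem_enum // exy nth_index ?mem_enum.
  apply/seteqP; split=> [_ [x xA <-]|i /= iA].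
    by rewrite /= cardE index_mem mem_enum.
  exists (enum_val (Ordinal iA)); first exact: enum_valP.
  rewrite (enum_val_nth (enum_default (Ordinal iA))) index_uniq ?enum_uniq //.
  by rewrite -cardE.
by rewrite -fA card_eq_sym; apply: inj_card_eq.
Qed.

Lemma card_ord_modn (n b : nat) (u : 'I_n.+1) :
  #|[set q : 'I_(n.+1 * b) | q %% n.+1 == u]%SET| = b.
Proof.
rewrite cardsE -sum1_card big_mkcond /= (eq_bigr (fun q : 'I__ =>
  if q %% n.+1 == u then 1 else 0)%N) //.
rewrite -(big_mkord xpredT (fun q => if q %% n.+1 == u then 1 else 0)%N).
elim: b => [|b IHb]; first by rewrite muln0 big_geq.
rewrite mulnS addnC (big_cat_nat _ (n := (n.+1 * b)%N)) ?leq_addr //= IHb -[b.+1]addn1.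
congr (_ + _)%N; rewrite -{1}[(n.+1 * b)%N]add0n big_addn addKn.
rewrite big_mkord (eq_bigr (fun r : 'I_n.+1 => if r == u then 1 else 0)%N).
  by rewrite -big_mkcond sum1_card card1.
by move=> r _; rewrite addnC mulnC modnMDl modn_small.
Qed.

(** Links form a type of their own, since they may be parallel and serve as the generators of the
    lift. [mg_node0] supplies a default value for hyperedge types. *)
Record typed_multigraph (tv te : nat) (D : 'M[nat]_(tv, te))
    (K : 'M[nat]_(te, tv)) := TypedMultigraph {
  mg_vertex : finType; mg_node : finType; mg_link : finType;
  mg_src : mg_link -> mg_vertex; mg_tgt : mg_link -> mg_node;
  mg_vtype : mg_vertex -> 'I_tv; mg_ntype : mg_node -> 'I_te;
  mg_vtype_surj : forall i, exists x, mg_vtype x = i;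
  mg_node0 : mg_node;
  mg_degree : forall x j,
    #|[set s | (mg_src s == x) && (mg_ntype (mg_tgt s) == j)]%SET| = D (mg_vtype x) j;
  mg_codegree : forall y i,
    #|[set s | (mg_tgt s == y) && (mg_vtype (mg_src s) == i)]%SET| = K (mg_ntype y) i
}.

(** For each pair of types, link number [q] joins the members numbered [q] modulo either class size.
    Both sizes divide the number of links suitably, so [card_ord_modn] gives the degrees on both
    sides. *)
Lemma biregular_multigraph (tv te : nat) (D : 'M[nat]_(tv, te))
    (K : 'M[nat]_(te, tv)) (n : 'I_tv -> nat) (m : 'I_te -> nat) (j0 : 'I_te) :
  (forall i j, ((n i).+1 * D i j = (m j).+1 * K j i)%N) ->
  typed_multigraph D K.
Proof.
move=> nm.
pose X : finType := {i : 'I_tv & 'I_(n i).+1}.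
pose Y : finType := {j : 'I_te & 'I_(m j).+1}.
pose S : finType := {p : 'I_tv * 'I_te & 'I_((n p.1).+1 * D p.1 p.2)}.
pose mkX i (u : 'I_(n i).+1) : X := Tagged (fun i => 'I_(n i).+1) u.
pose mkY j (u : 'I_(m j).+1) : Y := Tagged (fun j => 'I_(m j).+1) u.
pose mkS p (q : 'I_((n p.1).+1 * D p.1 p.2)) : S :=
  Tagged (fun p : 'I_tv * 'I_te => 'I_((n p.1).+1 * D p.1 p.2)) q.
have mkS_inj p : injective (@mkS p) by move=> q q' /eqP; rewrite eq_Tagged => /eqP.
pose src (s : S) : X := mkX (tag s).1 (inZp (tagged s)).
pose tgt (s : S) : Y := mkY (tag s).2 (inZp (tagged s)).
apply: (@TypedMultigraph _ _ _ _ X Y S src tgt (fun x => tag x) (fun y => tag y)).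
- by move=> i; exists (mkX i ord0).
- exact: (mkY j0 ord0).
- move=> [i u] j /=; rewrite -(card_ord_modn (D i j) u).
  rewrite -(card_imset _ (mkS_inj (i, j))).
  apply: eq_card => -[[i' j'] q]; rewrite inE /=.
  apply/andP/imsetP => [[/eqP e /eqP /= e']|[q' + eq_q]].
    have /= e1 := congr1 (fun x : X => tag x) e; subst i' j'; exists q => //.
    by rewrite inE; move/eqP: e; rewrite /src /mkX eq_Tagged /= => /eqP <-.
  have [? ?] := congr1 (fun s : S => tag s) eq_q; subst i' j'.
  rewrite (mkS_inj _ _ _ eq_q) inE => /eqP qu; split; last exact: eqxx.
  by rewrite /src /mkX eq_Tagged /=; apply/eqP/val_inj.
- move=> [j u] i /=.
  have := card_ord_modn (K j i) u; rewrite -nm => <-.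
  rewrite -(card_imset _ (mkS_inj (i, j))).
  apply: eq_card => -[[i' j'] q]; rewrite inE /=.
  apply/andP/imsetP => [[/eqP e /eqP /= e']|[q' + eq_q]].
    have /= e1 := congr1 (fun x : Y => tag x) e; subst i' j'; exists q => //.
    by rewrite inE; move/eqP: e; rewrite /tgt /mkY eq_Tagged /= => /eqP <-.
  have [? ?] := congr1 (fun s : S => tag s) eq_q; subst i' j'.
  rewrite (mkS_inj _ _ _ eq_q) inE => /eqP qu; split; last exact: eqxx.
  by rewrite /tgt /mkY eq_Tagged /=; apply/eqP/val_inj.
Qed.

(** * The lifted hypergraph *)

Section CoverHypergraph.
Variables (tv te : nat) (D : 'M[nat]_(tv, te)) (K : 'M[nat]_(te, tv)).
Variable (M : typed_multigraph D K) (L : nat).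
Hypothesis L4 : (4 <= L)%N.
Hypothesis K_gt1 : forall j, (1 < \sum_i K j i)%N.

Local Notation X := (mg_vertex M).
Local Notation Y := (mg_node M).
Local Notation S := (mg_link M).
Local Notation Gam := {perm word S L}.
Local Notation sg := (@word_perm S L).
Local Notation src := (@mg_src _ _ _ _ M).
Local Notation tgt := (@mg_tgt _ _ _ _ M).
Local Notation order := #|{: X * Gam}|.

(** The group coordinate runs over all permutations of the words: the lift may be disconnected,
    which does not affect balls. *)
Definition cover_vertex (x : X) (g : Gam) : 'I_order := enum_rank (x, g).
Definition cover_base (v : 'I_order) : X := (enum_val v).1.
Definition cover_perm (v : 'I_order) : Gam := (enum_val v).2.

Lemma cover_vertexK (v : 'I_order) : cover_vertex (cover_base v) (cover_perm v) = v.
Proof. by rewrite /cover_vertex /cover_base /cover_perm -surjective_pairing enum_valK. Qed.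

Lemma cover_base_vertex x g : cover_base (cover_vertex x g) = x.
Proof. by rewrite /cover_base enum_rankK. Qed.

Lemma cover_perm_vertex x g : cover_perm (cover_vertex x g) = g.
Proof. by rewrite /cover_perm enum_rankK. Qed.

(** The derived graph of the voltage assignment [sg]; its voltages are involutions, so a link acts
    alike in both directions. *)
Definition cover_link (v : 'I_order) (y : Y * Gam) (s : S) : Prop :=
  [/\ src s = cover_base v, tgt s = y.1 & y.2 = (cover_perm v * sg s)%g].

Definition cover_edge (y : Y * Gam) : set 'I_order :=
  [set v | exists s, cover_link v y s].

Lemma cover_link_inj_l v v' y s : cover_link v y s -> cover_link v' y s -> v = v'.
Proof.
move=> [so _ go] [so' _ go']; rewrite -(cover_vertexK v) -(cover_vertexK v') -so -so'.
by congr cover_vertex; apply: (mulIg (sg s)); rewrite -go -go'.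
Qed.

Lemma cover_link_inj_r v y y' s : cover_link v y s -> cover_link v y' s -> y = y'.
Proof.
by case: y y' => [a b] [a' b'] [_ /= to go] [_ /= to' go']; rewrite -to -to' go go'.
Qed.

Lemma cover_link_unique v y s s' : cover_link v y s -> cover_link v y s' -> s = s'.
Proof.
move=> [_ _ go] [_ _ go']; apply: (word_perm_inj (L := L) (g := cover_perm v)); first by lia.
by rewrite -go -go'.
Qed.

(** Distinct links at a node lead to distinct vertices, as distinct generators differ. Having two
    vertices is what lets a hyperedge be determined by its vertex set. *)
Lemma cover_edge_pair y : exists v v' s s',
  [/\ cover_link v y s, cover_link v' y s', v <> v' & s <> s'].
Proof.
have : (1 < #|[set s | tgt s == y.1]%SET|)%N.
  apply: leq_trans (K_gt1 (mg_ntype y.1)) _.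
  rewrite -[in X in (_ <= X)%N]sum1_card (partition_big (fun s => mg_vtype (src s)) xpredT) //=.
  apply: leq_sum => i _; rewrite -mg_codegree -sum1_card.
  by apply: eq_leq; apply: eq_bigl => s; rewrite !inE.
move=> /card_gt1P[s [s' []]]; rewrite !inE => /eqP ts /eqP ts' ss'.
pose v r := cover_vertex (src r) (y.2 * sg r)%g.
have lk r : tgt r = y.1 -> cover_link (v r) y r.
  by move=> tr; split=> //; rewrite ?cover_base_vertex // cover_perm_vertex word_permK.
exists (v s), (v s'), s, s'; split; [exact: lk|exact: lk| |exact/eqP].
move=> oo'; case/eqP: ss'; apply: (cover_link_unique (lk _ ts)).
by rewrite oo'; apply: lk.
Qed.

(* Two distinct hyperedges with two common vertices would close a reduced
   walk of length 4. *)
Lemma cover_edge_inj : injective cover_edge.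
Proof.
move=> y y' yy'; apply: contrapT => nyy'.
have [v [v' [s [s' [l1 l2 oo' ss']]]]] := cover_edge_pair y.
have [t l3] : cover_edge y' v by rewrite -yy'; exists s.
have [t' l4] : cover_edge y' v' by rewrite -yy'; exists s'.
apply: (@word_perm_no_relation S L (cover_perm v) [:: s; s'; t'; t]) => //=; last first.
  have [_ _ <-] := l1; have [_ _ ->] := l2; rewrite word_permK.
  by have [_ _ <-] := l4; have [_ _ ->] := l3; rewrite word_permK.
rewrite /no_repeat /= andbT; apply/and3P; split; apply/eqP => //.
- by move=> e; apply: nyy'; apply: (cover_link_inj_r l2); rewrite e.
- by move=> e; apply: oo'; apply: (cover_link_inj_l l3); rewrite -e.
Qed.

(** A hyperedge is a bare set, so its type is read off its preimage under [cover_edge], unique by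
    [cover_edge_inj]. *)
Definition cover_hypergraph : typed_hypergraph tv te 'I_order :=
  {| hyperedges := range cover_edge;
     vtype := fun v => mg_vtype (cover_base v);
     etype := fun e => mg_ntype (xget (mg_node0 M, 1%g) [set y | cover_edge y = e]).1
  |}.

Lemma cover_etype y : etype cover_hypergraph (cover_edge y) = mg_ntype y.1.
Proof.
by rewrite /= (@xget_unique _ _ _ y) // => z /cover_edge_inj.
Qed.

Lemma cover_vtype_surj i : exists v, vtype cover_hypergraph v = i.
Proof.
have [x <-] := mg_vtype_surj M i.
by exists (cover_vertex x 1%g); rewrite /= cover_base_vertex.
Qed.

Lemma cover_nonempty e : hyperedges cover_hypergraph e -> e !=set0.
Proof.
by case=> y _ <-; have [v [_ [s [_ [l _ _ _]]]]] := cover_edge_pair y; exists v, s.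
Qed.

Lemma cover_branching : branching_matrices cover_hypergraph D K.
Proof.
split=> [v j|_ i [y _ <-]].
  rewrite -[D _ _]/(D (mg_vtype (cover_base v)) j) -mg_degree; set A := finset _.
  apply: card_eq_trans (card_finset A).
  pose F s := cover_edge (tgt s, (cover_perm v * sg s)%g).
  have lF s : s \in A -> cover_link v (tgt s, (cover_perm v * sg s)%g) s.
    by rewrite inE => /andP[/eqP so _].
  rewrite (_ : mkset _ = F @` [set` A]).
    apply: inj_card_eq => s s' /set_mem sA /set_mem s'A /cover_edge_inj e.
    by apply: (cover_link_unique (lF _ sA)); rewrite e; apply: lF.
  apply/seteqP; split=> [_ [[y _ <-] [s [so sy gs]]]|_ [s sA <-]].
    rewrite cover_etype => ty.
    exists s; first by rewrite /= inE so sy ty !eqxx.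
    by rewrite /F -gs sy -surjective_pairing.
  split; [by exists (tgt s, (cover_perm v * sg s)%g)|by exists s; apply: lF|].
  rewrite cover_etype /=.
  by move: sA; rewrite /= inE => /andP[_ /eqP].
rewrite cover_etype /= -mg_codegree; set A := finset _.
apply: card_eq_trans (card_finset A).
pose F s := cover_vertex (src s) (y.2 * sg s)%g.
have lF s : s \in A -> cover_link (F s) y s.
  rewrite inE => /andP[/eqP ts _].
  by split=> //; rewrite ?cover_base_vertex // cover_perm_vertex word_permK.
rewrite (_ : mkset _ = F @` [set` A]).
  apply: inj_card_eq => s s' /set_mem sA /set_mem s'A e.
  by apply: (cover_link_unique (lF _ sA)); rewrite e; apply: lF.
apply/seteqP; split=> [v [[s ls] ti]|_ [s sA <-]].
  have sA : s \in A by case: ls => so sy _; rewrite inE so sy ti !eqxx.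
  by exists s => //; apply: (cover_link_inj_l (lF _ sA)).
split; first by exists s; apply: lF.
by move: sA; rewrite /= inE cover_base_vertex => /andP[_ /eqP].
Qed.

(** Incidences are coloured by the links they lift, with the group coordinate as [gam]. *)
Lemma cover_girth : girth_gt (@incidence_adj _ cover_hypergraph) L.
Proof.
have /choice[nd ndP] (e : set_type (hyperedges cover_hypergraph)) :
    exists y, cover_edge y = val e.
  by have [y _ ye] := set_mem (valP e); exists y.
pose E s (x z : 'I_order + set_type (hyperedges cover_hypergraph)) := match x, z with
  | inl v, inr e | inr e, inl v => cover_link v (nd e) s
  | _, _ => False end.
pose gam (x : 'I_order + set_type (hyperedges cover_hypergraph)) :=
  match x with inl v => cover_perm v | inr e => (nd e).2 end.
apply: (girth_of_edge_coloring (E := E) (gam := gam)).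
- by move=> [v|e] [v'|e'] //= /set_mem; rewrite -ndP.
- by move=> s [v|e] [v'|e'].
- move=> s [v|e] [v'|e'] [v2|e2] //= l l2.
    by congr inr; apply: val_inj; rewrite -!ndP (cover_link_inj_r l l2).
  by congr inl; apply: cover_link_inj_l l l2.
- move=> s [v|e] [v'|e'] //= [_ _ ->] //.
  by rewrite word_permK.
Qed.

Definition finite_cover : finite_typed_hypergraph tv te :=
  FiniteTypedHypergraph cover_vtype_surj.

End CoverHypergraph.

(** * Connectivity and positivity of the types *)

Lemma card_II_gt0 (U : Type) (A : set U) (n : nat) : A #= `I_n -> A !=set0 -> (0 < n)%N.
Proof.
move=> An [x Ax]; case: n An => //.
by rewrite II0 card_eq0 => /eqP A0; rewrite A0 in Ax.
Qed.

Lemma card_II_nonempty (U : Type) (A : set U) (n : nat) :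
  A #= `I_n -> (0 < n)%N -> A !=set0.
Proof.
move=> + n0; have [->|/set0P//] := eqVneq A set0.
by move=> /card_esym; rewrite card_eq0 => /eqP/seteqP[/(_ 0%N n0)].
Qed.

Lemma card_II_gt1 (U : choiceType) (A : set U) (n : nat) (x y : U) :
  A #= `I_n -> A x -> A y -> x <> y -> (1 < n)%N.
Proof.
move=> An Ax Ay xy.
have [f fI fA] := set_bijection_of_card 0%N An (card_eqxx `I_n).
have fx : (f @` A) (f x) by exists x.
have fy : (f @` A) (f y) by exists y.
have fxy : f x <> f y by move=> e; apply: xy; apply: (fI _ _ _ _ e); exact: mem_set.
by rewrite fA /= in fx fy; lia.
Qed.

Lemma card_II_distinct (U : choiceType) (A : set U) (n : nat) :
  A #= `I_n -> (1 < n)%N -> exists x y, [/\ A x, A y & x <> y].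
Proof.
move=> An n1; have [x _] := card_II_nonempty An (ltnW n1).
have An' := card_esym An.
have [f fI fA] := set_bijection_of_card x (card_eqxx `I_n) An.
exists (f 0%N), (f 1%N); rewrite -fA; split.
- by exists 0%N => //=; apply: ltnW.
- by exists 1%N.
- by move=> e; have := fI _ _ (mem_set (ltnW n1 : `I_n 0%N)) (mem_set (n1 : `I_n 1%N)) e.
Qed.

Section TypeGraph.
Variables (k d : nat) (V : choiceType) (tv te : nat).
Variables (T : typed_hypergraph tv te V) (G : set (V -> V)).
Variables (D : 'M[nat]_(tv, te)) (K : 'M[nat]_(te, tv)).
Hypotheses (k1 : (1 <= k)%N) (treeT : is_tree_hypergraph T k d).
Hypotheses (orbT : types_are_orbits T G) (brT : branching_matrices T D K).

Lemma branching_gt0_incidence (v : V) (e : set V) : hyperedges T e -> e v ->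
  (0 < D (vtype T v) (etype T e))%N /\ (0 < K (etype T e) (vtype T v))%N.
Proof.
move=> He ev; have [HD HK] := brT; split.
- by apply: card_II_gt0 (HD _ _) _; exists e.
- by apply: card_II_gt0 (HK _ _ He) _; exists v.
Qed.

Lemma branching_gt0 i j : ((0 < D i j) = (0 < K j i))%N.
Proof.
have [HD HK] := brT; apply/idP/idP.
- have [v <-] := vtype_surj orbT i => Dij.
  have [e [He ev <-]] := card_II_nonempty (HD v j) Dij.
  by have [] := branching_gt0_incidence He ev.
- have [e He <-] := etype_surj orbT j => Kij.
  have [v [ev <-]] := card_II_nonempty (HK e i He) Kij.
  by have [] := branching_gt0_incidence He ev.
Qed.

(** The property spreads along a walk of [T] between representatives, every incidence of which has a
    positive entry of [D]. *)
Lemma types_connected (P : 'I_tv + 'I_te -> Prop) :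
  (forall i j, (0 < D i j)%N -> P (inl i) <-> P (inr j)) ->
  forall a b, P a -> P b.
Proof.
move=> PD; have [[_ conn _] _ _] := treeT.
have surj a : exists x, incidence_type (H := T) x = a.
  case: a => [i|j]; first by have [v <-] := vtype_surj orbT i; exists (inl v).
  by have [e He <-] := etype_surj orbT j; exists (inr (exist _ e (mem_set He))).
move=> a b; have [x <-] := surj a; have [y <-] := surj b.
have [s xs <-] := conn x y; elim: s x xs => //= z s IHs x /andP[xz zs] Px.
apply: IHs zs _; case: x z xz Px => [v|e] [w|f] //= /set_mem ev.
- have [pos _] := branching_gt0_incidence (set_mem (valP f)) ev.
  by move/(PD _ _ pos).
- have [pos _] := branching_gt0_incidence (set_mem (valP e)) ev.
  by move/(PD _ _ pos).
Qed.

(** A hyperedge of [T] has at least two vertices: of different types they give two positive entries,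
    of equal type one entry above 1. *)
Lemma row_sum_gt1 j : (1 < \sum_i K j i)%N.
Proof.
have [e He <-] := etype_surj orbT j; have [_ HK] := brT.
have [_ _ /(_ (exist _ e (mem_set He)))] := treeT.
move=> /card_II_distinct[//|[v|f] [[w|f'] []//= /set_mem ev /set_mem ew vw]].
have {}vw : v <> w by move=> vw'; apply: vw; rewrite vw'.
have [_ Kv] := branching_gt0_incidence He ev.
have [_ Kw] := branching_gt0_incidence He ew.
have [tvw|tvw] := eqVneq (vtype T w) (vtype T v); last first.
  rewrite (bigD1 (vtype T v)) //= (bigD1 (vtype T w)) //=; lia.
apply: leq_trans (_ : K (etype T e) (vtype T v) <= _)%N; last first.
  by rewrite (bigD1 (vtype T v)) //= leq_addr.
exact: (card_II_gt1 (HK _ _ He) (conj ev erefl) (conj ew tvw) vw).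
Qed.

Lemma root_exists : exists v : V, True.
Proof.
have [[[[v|e]] _ _] _ degE] := treeT; first by exists v.
by have [//|[v|f] //= _] := card_II_nonempty (degE e); exists v.
Qed.

End TypeGraph.

(** * From reversibility to convergence *)

Local Open Scope ring_scope.

(** The diagonal blocks vanish and the two off-diagonal ones give the same equations; the
    denominators are absorbed into the weights. *)
Lemma reversible_balance (R : realType) (tv te k d : nat)
    (D : 'M[nat]_(tv, te)) (K : 'M[nat]_(te, tv)) (p : 'rV[R]_(tv + te)) :
  (forall a b, p 0 a * branching_chain R k d D K a b =
               p 0 b * branching_chain R k d D K b a) <->
  (forall i j, p 0 (lshift te i) / d.+1%:R * (D i j)%:R =
               p 0 (rshift tv j) / k.+1%:R * (K j i)%:R).
Proof.
split=> [bal i j|bal a b].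
  have := bal (lshift te i) (rshift tv j).
  by rewrite /branching_chain block_mxEur block_mxEdl !mxE !mulrA.
rewrite /branching_chain; case: (splitP a) => i ai; case: (splitP b) => j bj.
- have -> : a = lshift te i by apply: val_inj.
  have -> : b = lshift te j by apply: val_inj.
  by rewrite !block_mxEul !mxE !mulr0.
- have -> : a = lshift te i by apply: val_inj.
  have -> : b = rshift tv j by apply: val_inj.
  by rewrite block_mxEur block_mxEdl !mxE !mulrA bal.
- have -> : a = rshift tv i by apply: val_inj.
  have -> : b = lshift te j by apply: val_inj.
  by rewrite block_mxEur block_mxEdl !mxE !mulrA bal.
- have -> : a = rshift tv i by apply: val_inj.
  have -> : b = rshift tv j by apply: val_inj.
  by rewrite !block_mxEdr !mxE !mulr0.
Qed.

Lemma random_of_finite (R : realType) (tv te : nat)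
    (h : finite_typed_hypergraph tv te) :
  exists H : random_hypergraph R tv te,
    forall i (A : forall h : finite_typed_hypergraph tv te, 'I_(fin_order h) -> Prop),
      (forall v, vtype h v = i -> A h v) -> prob_uniform_root H i A = 1%E.
Proof.
pose H := @RandomHypergraph R tv te _ unit (dirac tt) (fun=> h) (fun _ => I).
exists H => i A hA; rewrite /prob_uniform_root.
transitivity (\int[rh_prob H]_w (cst 1 w))%E; last first.
  by rewrite integral_cst // mul1e [LHS]diracT.
apply: eq_integral => w _ /=.
have -> : [set v in vertices_of_type h i | `[< A h v >]]%SET = vertices_of_type h i.
  apply/setP => v; rewrite !inE; have [vi|] := eqVneq (vtype h v) i; last by [].
  by apply/asboolP/hA.
rewrite divff // pnatr_eq0 -lt0n; apply/card_gt0P.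
by have [v vi] := fin_vtype_surj h i; exists v; rewrite inE vi.
Qed.

Section Reversible.
Variables (R : realType) (k d : nat) (V : choiceType) (tv te : nat).
Variables (T : typed_hypergraph tv te V) (G : set (V -> V)).
Variables (D : 'M[nat]_(tv, te)) (K : 'M[nat]_(te, tv)).
Hypotheses (k1 : (1 <= k)%N) (treeT : is_tree_hypergraph T k d).
Hypotheses (orbT : types_are_orbits T G) (brT : branching_matrices T D K).

(* The ratios of the weights are rational, since types are connected by edges
   along which the weights are in integer ratio. *)
Lemma integral_weights (w : 'I_tv + 'I_te -> R) : (forall a, 0 < w a) ->
  (forall i j, w (inl i) * (D i j)%:R = w (inr j) * (K j i)%:R) ->
  exists (n : 'I_tv -> nat) (m : 'I_te -> nat),
    forall i j, ((n i).+1 * D i j = (m j).+1 * K j i)%N.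
Proof.
move=> w0 wDK; have [v _] := root_exists treeT; pose c := w (inl (vtype T v)).
pose Q b := exists u q : nat, [/\ (0 < u)%N, (0 < q)%N & w b * q%:R = c * u%:R].
have allQ b : Q b.
  apply: (types_connected treeT orbT brT (P := Q) _ (a := inl (vtype T v))).
    move=> i j Dij; have Kji : (0 < K j i)%N by rewrite -(branching_gt0 orbT brT).
    split=> -[u [q [u0 q0 uq]]].
    - exists (u * D i j)%N, (q * K j i)%N; rewrite !muln_gt0 u0 q0 Dij Kji; split=> //.
      rewrite !natrM mulrA mulrAC [X in _ = X]mulrA -uq -wDK.
      by rewrite mulrAC.
    - exists (u * K j i)%N, (q * D i j)%N; rewrite !muln_gt0 u0 q0 Dij Kji; split=> //.
      rewrite !natrM [LHS]mulrA [LHS]mulrAC wDK [RHS]mulrA -uq.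
      by rewrite mulrAC.
  by exists 1%N, 1%N.
have /choice[u /choice[q uqP]] := allQ.
(* [N] is a common denominator of the ratios [w b / c], and [z b] the resulting numerator. *)
pose N := (\prod_b q b)%N; pose z b := (u b * \prod_(a | a != b) q a)%N.
have z0 b : (0 < z b)%N.
  have [ub qb _] := uqP b; rewrite muln_gt0 ub prodn_gt0 // => a.
  by have [] := uqP a.
have wz b : w b * N%:R = c * (z b)%:R.
  have [_ _ e] := uqP b.
  by rewrite /N (bigD1 b) //= natrM mulrA e /z natrM mulrA.
clearbody z; exists (fun i => (z (inl i)).-1), (fun j => (z (inr j)).-1) => i j.
rewrite !prednK //; apply/eqP; rewrite -(eqr_nat R) !natrM.
rewrite -(inj_eq (mulfI (lt0r_neq0 (w0 (inl (vtype T v)))))) -/c !mulrA -!wz.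
by rewrite mulrAC wDK mulrAC.
Qed.

Lemma converges_of_reversible :
  time_reversible (branching_chain R k d D K) ->
  exists H : nat -> random_hypergraph R tv te, converges_locally H T.
Proof.
move=> [p [p0 _ /reversible_balance bal]].
pose w (a : 'I_tv + 'I_te) := match a with
  | inl i => p 0 (lshift te i) / d.+1%:R | inr j => p 0 (rshift tv j) / k.+1%:R end.
have [|n [m nm]] := @integral_weights w _ bal.
  by case=> a; rewrite divr_gt0 // ltr0n.
have [v0 _] := root_exists treeT.
(* A vertex has positive degree, so a hyperedge exists; its type serves as [j0] in
   [biregular_multigraph]. *)
have [[_ conn _] /(_ v0) dv0 _] := treeT.
have [[//|e] _] := card_II_nonempty dv0 isT.
pose M := biregular_multigraph (etype T (val e)) nm.
have L4 t : (4 <= t.*2.*2 + 4)%N by lia.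
have K1 := row_sum_gt1 k1 treeT orbT brT.
pose h t := finite_cover M (t.*2.*2 + 4)%N.
have /choice[H HP] t := @random_of_finite R tv te (h t).
exists H => t i v vi.
(* From index [t] on, every root has the required ball, so the probability is exactly 1. *)
apply: cvg_near_cst; exists t => // s /= ts.
apply: HP => u ui; apply: (@nbhd_iso_of_girth _ _ _ _ _ _ D K) => //.
- by case: treeT.
- exact: (@cover_branching _ _ _ _ M _ (L4 s) K1).
- exact: (@cover_nonempty _ _ _ _ M _ (L4 s) K1).
- move=> x q xq rq /andP[q0 qs]; apply: (@cover_girth _ _ _ _ M (s.*2.*2 + 4)%N _ _ xq rq).
  by rewrite q0 (leq_trans qs) // leq_add2r !leq_double.
- by rewrite vi -ui.
Qed.

End Reversible.

(** * Double counting around good vertices *)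

Section LocalDegrees.
Variables (tv te : nat) (V W : choiceType).
Variables (h : typed_hypergraph tv te W) (T : typed_hypergraph tv te V).
Variables (D : 'M[nat]_(tv, te)) (K : 'M[nat]_(te, tv)).
Hypothesis brT : branching_matrices T D K.

Lemma edge_in_ball (U : choiceType) (H : typed_hypergraph tv te U) (u w : U)
    (e : set U) : dist_le (vertex_adj H) 1 u w -> hyperedges H e -> e w ->
  e `<=` nbhd_set H 2 u.
Proof.
move=> uw He ew x ex; apply: (@dist_le_trans _ _ 1 1 _ w) => //.
by apply: dist_le1; apply/asboolP; exists e.
Qed.

Variables (u : W) (v : V).
Hypothesis iso : nbhd_iso 2 h u T v.

(** By [edge_in_ball], hyperedges through a vertex at distance at most 1 lie entirely in the ball of
    radius 2, in [h] and in [T], so the isomorphism sees all of them. *)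
Lemma local_degrees :
  (forall w, dist_le (vertex_adj h) 1 u w -> forall j,
     [set e | [/\ hyperedges h e, e w & etype h e = j]] #= `I_(D (vtype h w) j)) /\
  (forall e, hyperedges h e -> e u -> forall i,
     [set w | e w /\ vtype h w = i] #= `I_(K (etype h e) i)).
Proof.
have [g [gu gI gim gv ge gs]] := ball_iso_of_nbhd_iso iso.
have [HD HK] := brT.
have u0 : dist_le (vertex_adj h) 1 u u by exists [::].
have gdist w : dist_le (vertex_adj h) 1 u w -> dist_le (vertex_adj T) 1 v (g w).
  move=> [s [us <- ss]]; case: s us ss => [|x [|//]] /=.
    by rewrite gu; exists [::].
  rewrite andbT => /asboolP[e He [eu ex]] _.
  have eN := edge_in_ball u0 He eu.
  apply: dist_le1; apply/asboolP; exists (g @` e); first by have [] := ge _ eN He.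
  by split; [exists u | exists x].
split=> [w uw j|e He eu i].
  have Nw : nbhd_set h 2 u w by case: uw => s [? ? ?]; exists s; split=> //; apply: leqW.
  rewrite -gv //; apply: card_eq_trans (HD (g w) j).
  pose F (e : set W) := g @` e.
  rewrite (_ : [set e | [/\ hyperedges T e, _ & _]] =
    F @` [set e | [/\ hyperedges h e, e w & etype h e = j]]).
    rewrite card_eq_sym; apply: inj_card_eq.
    move=> e e' /set_mem[He ew _] /set_mem[He' ew' _] ee'.
    have eN := edge_in_ball uw He ew; have eN' := edge_in_ball uw He' ew'.
    apply/seteqP; split=> x ex.
    - have [y ey gxy] : (g @` e') (g x) by rewrite -[g @` e']ee'; exists x.
      suff <- : y = x by [].
      by apply: gI gxy; apply: mem_set; [apply: eN' | apply: eN].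
    - have [y ey gxy] : (g @` e) (g x) by rewrite [g @` e]ee'; exists x.
      suff <- : y = x by [].
      by apply: gI gxy; apply: mem_set; [apply: eN | apply: eN'].
  apply/seteqP; split=> [e' [He' ew' tj]|_ [e [He ew tj] <-]].
    have eN' := edge_in_ball (gdist _ uw) He' ew'.
    have [e [eN He gee]] := gs _ eN' He'.
    exists e => //; split=> //.
      move: ew'; rewrite -gee => -[x ex gxw].
      suff <- : x = w by [].
      by apply: gI gxw; apply: mem_set => //; apply: eN.
    by have [_ <-] := ge _ eN He; rewrite gee.
  have [He' te'] := ge _ (edge_in_ball uw He ew) He.
  by split=> //; [exists w | rewrite te'].
have eN := edge_in_ball u0 He eu.
have [He' <-] := ge _ eN He.
apply: card_eq_trans (HK _ i He').
rewrite (_ : [set w | (g @` e) w /\ _] = g @` [set w | e w /\ vtype h w = i]).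
  rewrite card_eq_sym; apply: inj_card_eq.
  by move=> x y /set_mem[ex _] /set_mem[ey _]; apply: gI; apply: mem_set; apply: eN.
apply/seteqP; split=> [_ [[x ex <-] tx]|_ [x [ex tx] <-]].
  by exists x => //; split=> //; rewrite -gv //; apply: eN.
by split; [exists x | rewrite gv //; apply: eN].
Qed.

End LocalDegrees.

Lemma card_finset_eq (U : finType) (A : {set U}) (n : nat) :
  [set` A] #= `I_n -> #|A| = n.
Proof.
by move=> An; apply/card_eq_II; apply: card_eq_trans An; rewrite card_eq_sym card_finset.
Qed.

Section DoubleCounting.
Variables (tv te : nat) (V : choiceType) (T : typed_hypergraph tv te V).
Variables (D : 'M[nat]_(tv, te)) (K : 'M[nat]_(te, tv)).
Hypothesis brT : branching_matrices T D K.
Variables (h : finite_typed_hypergraph tv te) (r : 'I_tv -> V).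

Local Notation U := 'I_(fin_order h).

Definition good_vertices (i : 'I_tv) : {set U} :=
  [set v in vertices_of_type h i | `[< nbhd_iso 2 h v T (r i) >]]%SET.

(* The hyperedges of type [j] that contain a good vertex; all their vertices
   have the degrees of [T], which is why balls of radius 2 are needed. *)
Definition good_edges (j : 'I_te) : {set {set U}} :=
  [set E : {set U} | `[< [/\ hyperedges h [set` E], etype h [set` E] = j
     & exists i, exists2 u, u \in good_vertices i & u \in E] >]]%SET.

Definition typed_edges (w : U) (j : 'I_te) : {set {set U}} :=
  [set E : {set U} | `[< [/\ hyperedges h [set` E], etype h [set` E] = j
     & w \in E] >]]%SET.

Lemma good_verticesP (i : 'I_tv) (u : U) :
  reflect (vtype h u = i /\ nbhd_iso 2 h u T (r i)) (u \in good_vertices i).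
Proof.
rewrite finset.in_set [u \in vertices_of_type h i]finset.in_set.
by apply: (iffP andP) => -[/eqP ? /asboolP].
Qed.

Lemma good_edgesP (j : 'I_te) (E : {set U}) :
  reflect [/\ hyperedges h [set` E], etype h [set` E] = j
     & exists i, exists2 u, u \in good_vertices i & u \in E] (E \in good_edges j).
Proof. by rewrite finset.in_set; apply: asboolP. Qed.

Lemma typed_edgesP (w : U) (j : 'I_te) (E : {set U}) :
  reflect [/\ hyperedges h [set` E], etype h [set` E] = j & w \in E]
    (E \in typed_edges w j).
Proof. by rewrite finset.in_set; apply: asboolP. Qed.

Lemma good_edge_card (i : 'I_tv) (j : 'I_te) (E : {set U}) :
  E \in good_edges j -> #|[set w in E | vtype h w == i]%SET| = K j i.
Proof.
move=> /good_edgesP[HE <- [i' [u /good_verticesP[_ iso] uE]]].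
have [_ HK] := local_degrees brT iso.
apply: card_finset_eq; apply: card_eq_trans (HK _ HE uE i).
rewrite (_ : [set` _] = [set w | [set` E] w /\ vtype h w = i]) //.
apply/seteqP; split=> w /=; rewrite finset.in_set.
  by move=> /andP[? /eqP].
by move=> [? /eqP ?]; apply/andP.
Qed.

Lemma typed_edges_card (w u : U) (i : 'I_tv) (j : 'I_te) :
  u \in good_vertices i -> dist_le (vertex_adj h) 1 u w ->
  #|typed_edges w j| = D (vtype h w) j.
Proof.
move=> /good_verticesP[_ iso] uw.
have [HD _] := local_degrees brT iso.
apply: card_finset_eq; apply: card_eq_trans (HD w uw j).
pose F (E : {set U}) : set U := [set` E].
rewrite (_ : [set e | [/\ hyperedges h e, e w & etype h e = j]] =
             F @` [set` typed_edges w j]).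
  rewrite card_eq_sym; apply: inj_card_eq => E E' _ _ /seteqP[EE' E'E].
  by apply/setP => x; apply/idP/idP => [/EE'|/E'E].
apply/seteqP; split=> [e [He ew te']|_ [E /= /typed_edgesP[] ? ? ? <-] //].
have eE : F [set x | x \in e]%SET = e.
  by apply/seteqP; split=> x; rewrite /F /= finset.in_set; [move/set_mem|move/mem_set].
exists [set x | x \in e]%SET => //=.
apply/typed_edgesP; rewrite -/(F _) eE finset.in_set; split=> //.
exact: mem_set.
Qed.

(** Either no good hyperedge contains [w], or one does and puts [w] at distance at most 1 from a
    good vertex, where degrees are those of [T]. *)
Lemma good_edges_at_le (i : 'I_tv) (j : 'I_te) (w : U) : vtype h w = i ->
  (#|[set E in good_edges j | w \in E]%SET| <= D i j)%N.
Proof.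
move=> wi; have [->|[E]] := set_0Vmem [set E in good_edges j | w \in E]%SET.
  by rewrite cards0.
rewrite finset.in_set => /andP[/good_edgesP[HE Ej [i' [u ug uE]]] wE].
rewrite -wi -(@typed_edges_card w u i' j ug); last first.
  by apply: dist_le1; apply/asboolP; exists [set` E].
apply/subset_leq_card/fintype.subsetP => E'.
rewrite finset.in_set => /andP[/good_edgesP[HE' Ej' _] wE'].
exact/typed_edgesP.
Qed.

Lemma good_edges_at_ge (i : 'I_tv) (j : 'I_te) (w : U) : w \in good_vertices i ->
  (D i j <= #|[set E in good_edges j | w \in E]%SET|)%N.
Proof.
move=> wg; have /good_verticesP[wi _] := wg.
rewrite -{1}wi -(@typed_edges_card w w i j wg); last by exists [::].
apply/subset_leq_card/fintype.subsetP => E /typed_edgesP[HE Ej wE].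
rewrite finset.in_set wE andbT.
by apply/good_edgesP; split=> //; exists i, w.
Qed.

(** The middle term counts incidences of good hyperedges with vertices of type [i]: at most [D i j]
    at any vertex, at least that many at a good one. *)
Lemma approximate_balance (i : 'I_tv) (j : 'I_te) :
  (#|good_vertices i| * D i j <= #|good_edges j| * K j i <=
   #|vertices_of_type h i| * D i j)%N.
Proof.
have -> : (#|good_edges j| * K j i =
    \sum_(w in vertices_of_type h i) #|[set E in good_edges j | w \in E]%SET|)%N.
  rewrite -sum_nat_const.
  transitivity (\sum_(E in good_edges j) \sum_(w in vertices_of_type h i | w \in E) 1)%N.
    apply: eq_bigr => E Eg; rewrite -(good_edge_card i Eg) -sum1_card.
    by apply: eq_bigl => w; rewrite !inE andbC.
  rewrite (exchange_big_dep (mem (vertices_of_type h i))) /=; last by move=> ? ? _ /andP[].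
  apply: eq_bigr => w wi; rewrite -sum1_card; apply: eq_bigl => E.
  by rewrite [RHS]inE [_ \in vertices_of_type h i]wi.
apply/andP; split; last first.
  rewrite -sum_nat_const; apply: leq_sum => w.
  by rewrite inE => /eqP; apply: good_edges_at_le.
rewrite -sum_nat_const [X in (_ <= X)%N](bigID (mem (good_vertices i))) /=.
apply: leq_trans (leq_addr _ _).
rewrite [X in (_ <= X)%N](eq_bigl (mem (good_vertices i))); last first.
  by move=> w; rewrite !inE /=; case: eqP.
by apply: leq_sum => w; apply: good_edges_at_ge.
Qed.

End DoubleCounting.

(** * Extracting one good outcome *)

Section GoodOutcome.
Variables (R : realType) (tv te : nat) (H : random_hypergraph R tv te).
Variable A : 'I_tv -> forall h : finite_typed_hypergraph tv te, 'I_(fin_order h) -> Prop.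

Definition fraction (i : 'I_tv) (h : finite_typed_hypergraph tv te) : R :=
  #|[set v in vertices_of_type h i | `[< A i v >]]%SET|%:R
  / #|vertices_of_type h i|%:R.

Lemma fraction_ge0 i h : 0 <= fraction i h.
Proof. by rewrite divr_ge0 ?ler0n. Qed.

Lemma vertices_of_type_gt0 (h : finite_typed_hypergraph tv te) i :
  (0 < #|vertices_of_type h i|)%N.
Proof.
by have [v vi] := fin_vtype_surj h i; apply/card_gt0P; exists v; rewrite inE vi.
Qed.

Lemma fraction_le1 i h : fraction i h <= 1.
Proof.
rewrite ler_pdivrMr ?ltr0n ?vertices_of_type_gt0 // mul1r ler_nat.
by apply/subset_leq_card/fintype.subsetP => v; rewrite inE => /andP[].
Qed.

Lemma measurable_fraction i :
  measurable_fun [set: rh_space H] (fun w => (fraction i (H w))%:E : \bar R).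
Proof.
move=> _ B _; rewrite setTI.
exact: (@rh_measurable _ _ _ H [set h | B (fraction i h)%:E]).
Qed.

(** If every outcome failed for some type, the sum of the fractions would never exceed [tv - e],
    while its mean is at least [tv - e * tv / (tv + 1)]. The denominator [tv + 1] makes this
    strictly larger. *)
Lemma exists_good_outcome (e : R) : 0 < e ->
  (forall i, ((1 - e / tv.+1%:R)%:E <= prob_uniform_root H i (A i))%E) ->
  exists w, forall i, 1 - e <= fraction i (H w).
Proof.
move=> e0 He; apply: contrapT => none.
have bad w : \sum_i fraction i (H w) <= tv%:R - e.
  have /existsNP[i /negP] : ~ forall i, 1 - e <= fraction i (H w).
    by move=> all; apply: none; exists w.
  rewrite -ltNge => lt_i; rewrite (bigD1 i) //=.
  have le_tv : \sum_(j < tv | j != i) fraction j (H w) <= tv%:R - 1.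
    apply: le_trans (_ : \sum_(j < tv | j != i) (1 : R) <= _).
      by apply: ler_sum => j _; apply: fraction_le1.
    have -> : tv%:R = \sum_(j < tv) (1 : R) by rewrite sumr_const card_ord.
    by rewrite [X in _ <= X - _](bigD1 i) //=; lra.
  by lra.
have : (\sum_(i < tv) (1 - e / tv.+1%:R)%:E <= (tv%:R - e)%:E)%E.
  apply: (@le_trans _ _ (\sum_(i < tv) prob_uniform_root H i (A i))%E).
    by apply: lee_sum.
  rewrite -ge0_integral_sum //; last by move=> i; apply: measurable_fraction.
  apply: (@le_trans _ _ (\int[rh_prob H]_w (cst (tv%:R - e)%:E w))%E); last first.
    by rewrite integral_cst // [X in (_ * X)%E]probability_setT mule1.
  apply: ge0_le_integral => //.
  - by move=> w _; apply: sume_ge0 => i _; rewrite lee_fin; apply: fraction_ge0.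
  - by apply: emeasurable_sum => i; apply: measurable_fraction.
  - by move=> w _; rewrite sumEFin lee_fin; apply: bad.
rewrite sumEFin lee_fin sumr_const card_ord -[X in X <= _]mulr_natl.
rewrite mulrBr mulr1 lerD2l lerN2 => le_e.
have : tv%:R * (e / tv.+1%:R) < e.
  by rewrite mulrCA gtr_pMr // ltr_pdivrMr ?ltr0n // mul1r ltr_nat.
by rewrite ltNge le_e.
Qed.

End GoodOutcome.

(* An approximate kernel forces an exact one: otherwise [A] has a right
   inverse, which bounds a row vector by its image. *)
Lemma kernel_of_approximate_kernel (R : realFieldType) (n m : nat) (A : 'M[R]_(n, m)) :
  (forall e : R, 0 < e -> exists p : 'rV[R]_n,
     [/\ 0 < \sum_a `|p 0 a| &
         forall c, `|(p *m A) 0 c| <= e * \sum_a `|p 0 a|]) ->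
  exists2 p : 'rV[R]_n, p != 0 & p *m A = 0.
Proof.
move=> approx; have [/row_freeP[B AB]|nfree] := boolP (row_free A); last first.
  have : kermx A != 0 by rewrite kermx_eq0.
  move=> /rowV0Pn[p /sub_kermxP pA p0]; by exists p.
pose C := \sum_a \sum_c `|B c a|.
have C0 : 0 <= C by apply: sumr_ge0 => a _; apply: sumr_ge0.
(* [C] bounds the right inverse, and [C / (C + 1) < 1] contradicts [p = p *m A *m B]. *)
have [|p [p0 pA]] := approx (C + 1)^-1; first by rewrite invr_gt0; lra.
have pE : p = p *m A *m B by rewrite -mulmxA AB mulmx1.
have : \sum_a `|p 0 a| <= (C + 1)^-1 * (\sum_a `|p 0 a|) * C.
  rewrite {1}pE mulr_sumr; apply: ler_sum => a _; rewrite mxE.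
  apply: le_trans (ler_norm_sum _ _ _) _; rewrite mulr_sumr.
  by apply: ler_sum => c _; rewrite normrM ler_wpM2r.
rewrite mulrAC ler_pMl //.
by rewrite leNgt ltr_pdivrMl ?mulr1; lra.
Qed.

(** * From convergence to reversibility *)

Section Necessity.
Variables (R : realType) (k d : nat) (V : choiceType) (tv te : nat).
Variables (T : typed_hypergraph tv te V) (G : set (V -> V)).
Variables (D : 'M[nat]_(tv, te)) (K : 'M[nat]_(te, tv)).
Hypotheses (k1 : (1 <= k)%N) (treeT : is_tree_hypergraph T k d).
Hypotheses (orbT : types_are_orbits T G) (brT : branching_matrices T D K).

Lemma reversible_of_balance (w : 'I_tv + 'I_te -> R) : (exists a, w a != 0) ->
  (forall i j, w (inl i) * (D i j)%:R = w (inr j) * (K j i)%:R) ->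
  time_reversible (branching_chain R k d D K).
Proof.
move=> [a0 wa0] bal.
have balN i j : `|w (inl i)| * (D i j)%:R = `|w (inr j)| * (K j i)%:R.
  by rewrite -[(D i j)%:R]normr_nat -[(K j i)%:R]normr_nat -!normrM bal.
have w0 b : w b != 0.
  pose P b : Prop := w b != 0.
  apply: (types_connected treeT orbT brT (P := P) _ (a := a0)) => // i j Dij.
  have Kij : (0 < K j i)%N by rewrite -(branching_gt0 orbT brT).
  have := bal i j; split=> wn0; apply/eqP => e0; move: (bal i j); rewrite e0 mul0r.
  - by move/eqP; rewrite mulf_eq0 (negbTE wn0) pnatr_eq0 -leqn0 leqNgt Dij.
  - by move/esym/eqP; rewrite mulf_eq0 (negbTE wn0) pnatr_eq0 -leqn0 leqNgt Kij.
(* The factors [d + 1] and [k + 1] undo the scaling in [reversible_balance]. *)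
pose q (a : 'I_(tv + te)) := match fintype.split a with
  | inl i => `|w (inl i)| * d.+1%:R | inr j => `|w (inr j)| * k.+1%:R end.
have q0 a : 0 < q a.
  by rewrite /q; case: (fintype.split a) => b; rewrite mulr_gt0 ?normr_gt0 ?ltr0n.
have a1 : 'I_(tv + te) by case: a0 {wa0} => b; [exact: lshift|exact: rshift].
have Z0 : 0 < \sum_a q a.
  by rewrite (bigD1 a1) //= ltr_pwDl // sumr_ge0 // => a _; apply: ltW.
exists (\row_a (q a / \sum_b q b)); split.
- by move=> a; rewrite mxE divr_gt0.
- under eq_bigr do rewrite mxE.
  by rewrite -mulr_suml divff // lt0r_neq0.
- apply/reversible_balance => i j; rewrite !mxE /q.
  rewrite (unsplitK (inl i)) (unsplitK (inr j)).
  rewrite ![_ / (\sum_b _) / _]mulrAC !mulfK ?pnatr_eq0 //.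
  by rewrite mulrAC balN mulrAC.
Qed.

Lemma reversible_of_converges (H : nat -> random_hypergraph R tv te) :
  converges_locally H T -> time_reversible (branching_chain R k d D K).
Proof.
move=> conv.
have /choice[r rP] i := vtype_surj orbT i.
have [v0 _] := root_exists treeT.
have good e : 0 < e -> exists h : finite_typed_hypergraph tv te, forall i,
    (1 - e) * #|vertices_of_type h i|%:R <= #|good_vertices T h r i|%:R :> R.
  move=> e0.
  (* There are finitely many types, so one index serves them all. *)
  have : \forall n \near \oo, forall i, ((1 - e / tv.+1%:R)%:E <=
      prob_uniform_root (H n) i (fun h u => nbhd_iso 2 h u T (r i)))%E.
    apply: filter_forall => i.
    have := conv 2%N i (r i) (rP i) [set x | ((1 - e / tv.+1%:R)%:E <= x)%E]; apply.
    suff : nbhs (1 : R) [set x : R | ((1 - e / tv.+1%:R)%:E <= x%:E)%E] by [].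
    apply/nbhs_ballP; exists (e / tv.+1%:R); first by rewrite /= divr_gt0 ?ltr0n.
    move: (e / tv.+1%:R) => dl x; rewrite /ball /= ltr_norml lee_fin => /andP[? ?].
    lra.
  case=> n _ /(_ n (leqnn n)) /(exists_good_outcome e0)[w wP].
  exists (H n w) => i; rewrite -ler_pdivlMr ?ltr0n ?vertices_of_type_gt0 //.
  exact: wP.
(* One column per pair of types: [p *m A = 0] collects all balance equations. *)
pose m := #|{: 'I_tv * 'I_te}|.
pose A : 'M[R]_(tv + te, m) := \matrix_(a, c)
  let ij := enum_val c : 'I_tv * 'I_te in
  match fintype.split a with
  | inl i => if i == ij.1 then (D ij.1 ij.2)%:R else 0
  | inr j => if j == ij.2 then - (K ij.2 ij.1)%:R else 0 end.
have pAE (p : 'rV_(tv + te)) c : (p *m A) 0 c =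
    p 0 (lshift te (enum_val c).1) * (D (enum_val c).1 (enum_val c).2)%:R -
    p 0 (rshift tv (enum_val c).2) * (K (enum_val c).2 (enum_val c).1)%:R.
  rewrite mxE big_split_ord /=; congr (_ + _).
    rewrite (bigD1 (enum_val c).1) //= big1 => [|i ic].
      by rewrite addr0 mxE (unsplitK (inl _)) /= eqxx.
    by rewrite mxE (unsplitK (inl _)) /= (negbTE ic) mulr0.
  rewrite (bigD1 (enum_val c).2) //= big1 => [|i ic].
    by rewrite addr0 mxE (unsplitK (inr _)) /= eqxx mulrN.
  by rewrite mxE (unsplitK (inr _)) /= (negbTE ic) mulr0.
have [|p p0 pA] := @kernel_of_approximate_kernel R _ _ A.
  move=> e e0; pose C := \sum_i \sum_j (D i j)%:R : R.
  have C0 : 0 <= C by apply: sumr_ge0 => i _; apply: sumr_ge0.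
  (* The defect of a balance equation is at most this tolerance times [N * D i j], where [N] is
     bounded by the norm of [p] and [D i j] by [C + 1]. *)
  have [|h hP] := good (e / (C + 1)); first by rewrite divr_gt0 //; lra.
  pose p := \row_(a < tv + te) match fintype.split a with
    | inl i => #|vertices_of_type h i|%:R : R
    | inr j => #|good_edges T h r j|%:R end.
  have pl i : p 0 (lshift te i) = #|vertices_of_type h i|%:R.
    by rewrite mxE (unsplitK (inl _)).
  have pr j : p 0 (rshift tv j) = #|good_edges T h r j|%:R.
    by rewrite mxE (unsplitK (inr _)).
  have p_ge i : #|vertices_of_type h i|%:R <= \sum_a `|p 0 a|.
    by rewrite (bigD1 (lshift te i)) //= pl normr_nat lerDl sumr_ge0.
  exists p; split.
    apply: lt_le_trans (p_ge (vtype T v0)).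
    by rewrite ltr0n vertices_of_type_gt0.
  move=> c; rewrite pAE pl pr; case: (enum_val c) => i j /=.
  have /andP[] := approximate_balance brT h r i j.
  rewrite -!(ler_nat R) !natrM; move: (hP i) (p_ge i) (ler0n R #|vertices_of_type h i|).
  move: (#|vertices_of_type h i|%:R : R) (#|good_vertices T h r i|%:R : R) => N g.
  move: (#|good_edges T h r j|%:R * (K j i)%:R) (\sum_a `|p 0 a|) => M S gN NS N0 gM MN.
  have D0 : 0 <= (D i j)%:R :> R by [].
  have DC : (D i j)%:R <= C + 1.
    rewrite /C (bigD1 i) //= (bigD1 j) //= -!addrA lerDl !addr_ge0 ?sumr_ge0 //.
    by move=> ? _; apply: sumr_ge0.
  have gD := ler_wpM2r D0 gN.
  have dl0 : 0 <= e / (C + 1) by rewrite divr_ge0 //; lra.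
  rewrite ger0_norm ?subr_ge0 //.
  apply: (@le_trans _ _ (e / (C + 1) * (N * (D i j)%:R))).
    by move: gD; rewrite mulrBl mul1r mulrBl mulrA; lra.
  have -> : e * S = e / (C + 1) * (S * (C + 1)).
    by field; apply: lt0r_neq0; lra.
  rewrite ler_wpM2l //; apply: ler_pM => //.
pose w (a : 'I_tv + 'I_te) := match a with
  inl i => p 0 (lshift te i) | inr j => p 0 (rshift tv j) end.
apply: (@reversible_of_balance w).
  have /rV0Pn[a pa] := p0.
  exists (fintype.split a); rewrite /w.
  by case: splitP pa => b ab; congr (p 0 _ != 0); apply: val_inj.
move=> i j; have := pAE p (enum_rank (i, j)).
by rewrite pA mxE enum_rankK /= => /esym/eqP; rewrite subr_eq0 => /eqP.
Qed.

End Necessity.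

Theorem theorem26 (R : realType) (k d : nat) (V : choiceType) (tv te : nat)
    (T : typed_hypergraph tv te V) (G : set (V -> V))
    (D : 'M[nat]_(tv, te)) (K : 'M[nat]_(te, tv)) :
  (1 <= k)%N -> (1 <= d)%N ->
  is_tree_hypergraph T k d ->
  automorphism_group T G ->
  types_are_orbits T G ->
  branching_matrices T D K ->
  (exists H : nat -> random_hypergraph R tv te, converges_locally H T) <->
  time_reversible (branching_chain R k d D K).
Proof.
move=> k1 _ treeT _ orbT brT; split=> [[H]|].
- exact: (reversible_of_converges treeT orbT brT).
- exact: (converges_of_reversible k1 treeT orbT brT).
Qed.
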